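(* Let $n\ge 1$, let $\omega_0$ be the standard symplectic form on $\mathbb R^{2n}$, and let $\operatorname{Sp}(2n,\mathbb R)\subset\operatorname{GL}(\mathbb R^{2n})$ be the group of linear automorphisms preserving $\omega_0$. Let $(M,\nabla,P)$ be an infinitesimally homogeneous affine manifold with $G$-structure, with structure group $G=\operatorname{Sp}(2n,\mathbb R)$. Then $P$ is the bundle of symplectic frames of a symplectic form $\omega$ on $M$, and $\nabla$ is a flat torsion-free symplectic connection. Equivalently, $T=0$, $R=0$ and $\nabla\omega=0$, where $T$ and $R$ are the torsion and curvature of $\nabla$. Conversely, let $(M,\omega)$ be a symplectic manifold of dimension $2n$ endowed with a flat torsion-free connection $\nabla$ such that $\nabla\omega=0$. If $P$ denotes the bundle of symplectic frames of $\omega$, then $(M,\nabla,P)$ is infinitesimally homogeneous with structure group $\operatorname{Sp}(2n,\mathbb R)$.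
   Context: Let $V$ be a finite-dimensional real vector space and $G\subseteq\operatorname{GL}(V)$ a Lie subgroup with Lie algebra $\mathfrak g\subseteq\mathfrak{gl}(V)$. A $G$-structure on a smooth manifold $M$ with $\dim M=\dim V$ is a principal $G$-subbundle $P$ of the frame bundle $\operatorname{FR}(TM)$; elements $p\in P_x$ are linear isomorphisms $p:V\to T_xM$, and two frames in $P_x$ differ by right composition with an element of $G$. An affine manifold with $G$-structure is a triple $(M,\nabla,P)$ with $\nabla$ an affine connection on $M$ and $P$ a $G$-structure. Put $T(X,Y)=\nabla_XY-\nabla_YX-[X,Y]$ and $R(X,Y)=\nabla_X\nabla_Y-\nabla_Y\nabla_X-\nabla_{[X,Y]}$. Inner torsion: for a local section $s:U\to P$ define $\Lambda^s_x(u)\in\mathfrak{gl}(V)$ by $\nabla_{s(x)u}(s\,w)=s(x)(\Lambda^s_x(u)w)$ for $u,w\in V$, where $s\,w$ is the vector field $x\mapsto s(x)w$. With $\mathfrak g_x=\operatorname{Ad}_p(\mathfrak g)$ for any $p\in P_x$ and $\overline{\operatorname{Ad}}_p:\mathfrak{gl}(V)/\mathfrak g\to\mathfrak{gl}(T_xM)/\mathfrak g_x$ induced by conjugation by $p$, the inner torsion is the map $\mathfrak I^P_x:T_xM\to\mathfrak{gl}(T_xM)/\mathfrak g_x$, $\mathfrak I^P_x(s(x)u)=\overline{\operatorname{Ad}}_{s(x)}(\Lambda^s_x(u)+\mathfrak g)$ (independent of $s$). $(M,\nabla,P)$ is infinitesimally homogeneous if there are linear maps $T_0:\Lambda^2V\to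 V$, $R_0:\Lambda^2V\to\mathfrak{gl}(V)$, $\mathfrak I_0:V\to\mathfrak{gl}(V)/\mathfrak g$ (the characteristic tensors) with $T_x(pu,pv)=p\,T_0(u,v)$, $R_x(pu,pv)pw=p\,R_0(u,v)w$, $\mathfrak I^P_x(pu)=\overline{\operatorname{Ad}}_p(\mathfrak I_0(u))$ for all $x\in M$, $p\in P_x$, $u,v,w\in V$. The bundle of symplectic frames of a nondegenerate $2$-form $\omega$ on $M$ consists of the linear isomorphisms $p:\mathbb R^{2n}\to T_xM$ with $p^*\omega_x=\omega_0$. A connection $\nabla$ is symplectic for $\omega$ if $\nabla\omega=0$. *)

(* Defs.v *)
From HB Require Import structures.
From mathcomp Require Import all_boot all_order all_algebra.
From mathcomp Require Import all_classical all_reals all_analysis.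

Set Implicit Arguments.
Unset Strict Implicit.
Unset Printing Implicit Defensive.

Import Order.TTheory GRing.Theory Num.Theory numFieldNormedType.Exports.

Local Open Scope classical_set_scope.
Local Open Scope ring_scope.

(** ** Smooth maps between normed modules *)

Fixpoint Ck (R : realType) (V W : normedModType R) (k : nat)
    (U : set V) (f : V -> W) : Prop :=
  match k with
  | 0 => forall x, U x -> {for x, continuous f}
  | k'.+1 => (forall x, U x -> differentiable f x) /\
             (forall v, Ck k' U ('D_v f))
  end.

(* Only used for open [U]. *)
Definition smooth_on (R : realType) (V W : normedModType R)
  (U : set V) (f : V -> W) : Prop := forall k, Ck k U f.

(** ** Manifolds *)

Record chart (R : realType) (m : nat) (T : topologicalType) := Chart {
  dom : set T;
  coord : T -> 'cV[R]_m;
  param : 'cV[R]_m -> T;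
  dom_open : open dom;
  coord_open : open (coord @` dom);
  coordK : forall x, dom x -> param (coord x) = x;
  coord_continuous : {within dom, continuous coord};
  param_continuous : {within coord @` dom, continuous param} }.

(* The smooth structure is given by an atlas indexed by the points of the
   manifold, the chart of index [x] being defined around [x].  Any atlas can be
   put in this form without changing the smooth structure: choose a chart of
   the atlas around each point. *)
Record manifold (R : realType) (m : nat) := Manifold {
  points :> topologicalType;
  manifold_hausdorff : hausdorff_space points;
  manifold_second_countable : @second_countable points;
  chart_at : points -> chart R m points;
  mem_chart : forall x, dom (chart_at x) x;
  transition_smooth : forall x y,
    smooth_on (coord (chart_at x) @` (dom (chart_at x) `&` dom (chart_at y)))
              (coord (chart_at y) \o param (chart_at x)) }.

(* A tangent vector at [x] is given by its components in the chart [chart_at x].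
   Hence a linear map from R^m to [tangent x] and an endomorphism of [tangent x]
   are m x m matrices acting on columns. *)
Definition tangent (R : realType) (m : nat) (M : manifold R m) (x : M) : Type :=
  'cV[R]_m.

Definition vfield (R : realType) (m : nat) (M : manifold R m) : Type :=
  forall x : M, tangent x.

(* Components of [v] in [chart_at z], for [x] in the domain of this chart. *)
Definition tangent_coord (R : realType) (m : nat) (M : manifold R m)
    (z x : M) (v : tangent x) : 'cV[R]_m :=
  'd (coord (chart_at z) \o param (chart_at x)) (coord (chart_at x) x) v.
Arguments tangent_coord {R m M} z x v.

Definition vfield_coord (R : realType) (m : nat) (M : manifold R m)
    (z : M) (X : vfield M) (xi : 'cV[R]_m) : 'cV[R]_m :=
  tangent_coord z (param (chart_at z) xi) (X (param (chart_at z) xi)).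

(* Functions and vector fields are total; only their restriction to an open set
   on which they are smooth is meaningful. *)
Definition smooth_fun_on (R : realType) (m : nat) (M : manifold R m)
    (U : set M) (f : M -> R) : Prop :=
  forall z, smooth_on (coord (chart_at z) @` (dom (chart_at z) `&` U))
                      (f \o param (chart_at z)).

Definition smooth_fun_near (R : realType) (m : nat) (M : manifold R m)
    (x : M) (f : M -> R) : Prop :=
  exists2 U, open_nbhs x U & smooth_fun_on U f.

Definition smooth_vfield_on (R : realType) (m : nat) (M : manifold R m)
    (U : set M) (X : vfield M) : Prop :=
  forall z, smooth_on (coord (chart_at z) @` (dom (chart_at z) `&` U))
                      (vfield_coord z X).

Definition smooth_vfield_near (R : realType) (m : nat) (M : manifold R m)
    (x : M) (X : vfield M) : Prop :=
  exists2 U, open_nbhs x U & smooth_vfield_on U X.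

Definition dfun (R : realType) (m : nat) (M : manifold R m)
    (f : M -> R) (x : M) (v : tangent x) : R :=
  'd (f \o param (chart_at x)) (coord (chart_at x) x) v.
Arguments dfun {R m M} f x v.

Definition lie_bracket (R : realType) (m : nat) (M : manifold R m)
    (X Y : vfield M) : vfield M := fun x : M =>
  ('d (vfield_coord x Y) (coord (chart_at x) x) (X x)
   - 'd (vfield_coord x X) (coord (chart_at x) x) (Y x) : 'cV[R]_m).

(** ** Affine connections *)

(* [nabla x v Y] is the covariant derivative of [Y] at [x] in the direction [v];
   its value is only constrained when [Y] is smooth near [x].  The Leibniz rule
   for functions [f] that are smooth near [x], in particular for the indicator
   function of a neighbourhood of [x], makes [nabla x v Y] depend only on the
   germ of [Y] at [x]. *)
Record connection (R : realType) (m : nat) (M : manifold R m) := Connection {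
  nabla :> forall x : M, tangent x -> vfield M -> tangent x;
  nabla_linear : forall (x : M) (Y : vfield M) (a : R) (u v : tangent x),
    smooth_vfield_near x Y ->
    @nabla x (a *: u + v) Y = a *: @nabla x u Y + @nabla x v Y;
  nabla_add : forall (x : M) (v : tangent x) (Y Z : vfield M),
    smooth_vfield_near x Y -> smooth_vfield_near x Z ->
    @nabla x v (fun y => Y y + Z y) = @nabla x v Y + @nabla x v Z;
  nabla_leibniz : forall (x : M) (v : tangent x) (f : M -> R) (Y : vfield M),
    smooth_fun_near x f -> smooth_vfield_near x Y ->
    @nabla x v (fun y => f y *: Y y) = dfun f x v *: Y x + f x *: @nabla x v Y;
  nabla_smooth : forall (U : set M) (X Y : vfield M), open U ->
    smooth_vfield_on U X -> smooth_vfield_on U Y ->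
    smooth_vfield_on U (fun x => @nabla x (X x) Y) }.

Definition cov (R : realType) (m : nat) (M : manifold R m)
    (D : connection M) (X Y : vfield M) : vfield M := fun x => D x (X x) Y.

Definition torsion (R : realType) (m : nat) (M : manifold R m)
    (D : connection M) (X Y : vfield M) (x : M) : 'cV[R]_m :=
  cov D X Y x - cov D Y X x - lie_bracket X Y x.

Definition curvature (R : realType) (m : nat) (M : manifold R m)
    (D : connection M) (X Y Z : vfield M) (x : M) : 'cV[R]_m :=
  cov D X (cov D Y Z) x - cov D Y (cov D X Z) x
  - cov D (lie_bracket X Y) Z x.

Definition torsion_free (R : realType) (m : nat) (M : manifold R m)
    (D : connection M) : Prop :=
  forall (x : M) (X Y : vfield M),
    smooth_vfield_near x X -> smooth_vfield_near x Y -> torsion D X Y x = 0.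

Definition flat (R : realType) (m : nat) (M : manifold R m)
    (D : connection M) : Prop :=
  forall (x : M) (X Y Z : vfield M),
    smooth_vfield_near x X -> smooth_vfield_near x Y ->
    smooth_vfield_near x Z -> curvature D X Y Z x = 0.

(** ** G-structures and inner torsion *)

(* Velocities at the identity of the smooth curves in [G] through 1. *)
Definition lie_algebra (R : realType) (m : nat) (G : set 'M[R]_m) :
    set 'M[R]_m :=
  [set A | exists (gamma : R -> 'M[R]_m) (U : set R),
     [/\ open_nbhs 0 U, smooth_on U gamma, (forall t, U t -> G (gamma t)),
         gamma 0 = 1%:M & derive1 gamma 0 = A]].

(* [P x] is a set of frames of [tangent x], a frame being an isomorphism from
   V = R^m to [tangent x]. *)
Definition local_section (R : realType) (m : nat) (M : manifold R m)
    (P : M -> set 'M[R]_m) (U : set M) (s : M -> 'M[R]_m) : Prop :=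
  (forall y, U y -> P y (s y)) /\
  (forall w : 'cV[R]_m,
     smooth_vfield_on U (fun y => s y *m w : tangent y)).

Definition G_structure (R : realType) (m : nat) (M : manifold R m)
    (G : set 'M[R]_m) (P : M -> set 'M[R]_m) : Prop :=
  [/\ forall x p, P x p -> p \in unitmx,
      forall x p, P x p -> P x = [set p *m g | g in G] &
      forall x, exists s U, open_nbhs x U /\ local_section P U s].

(* The class of [A] in the quotient gl(R^m)/g. *)
Definition coset (R : realType) (m : nat) (g : set 'M[R]_m) (A : 'M[R]_m) :
    set 'M[R]_m :=
  [set A + B | B in g].

Definition linear_to_quotient (R : realType) (m : nat) (g : set 'M[R]_m)
    (I : 'cV[R]_m -> set 'M[R]_m) : Prop :=
  (forall u, exists A, I u = coset g A) /\
  (forall a u v A B, I u = coset g A -> I v = coset g B ->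
     I (a *: u + v) = coset g (a *: A + B)).

Definition Ad (R : realType) (m : nat) (p A : 'M[R]_m) : 'M[R]_m :=
  p *m A *m invmx p.

Definition is_Lambda (R : realType) (m : nat) (M : manifold R m)
    (D : connection M) (s : M -> 'M[R]_m) (x : M) (u : 'cV[R]_m)
    (L : 'M[R]_m) : Prop :=
  forall w : 'cV[R]_m,
    D x (s x *m u) (fun y => s y *m w : tangent y) = s x *m (L *m w).

(* The coset of Ad_p(g) in gl(T_x M) is obtained as the union, over all local
   sections [s] of [P] around [x], of the cosets which they define; they all
   coincide. *)
Definition inner_torsion (R : realType) (m : nat) (M : manifold R m)
    (G : set 'M[R]_m) (D : connection M) (P : M -> set 'M[R]_m)
    (x : M) (v : tangent x) : set 'M[R]_m :=
  [set B | exists s U u L,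
     [/\ open_nbhs x U, local_section P U s, s x *m u = v,
         is_Lambda D s x u L & (Ad (s x) @` coset (lie_algebra G) L) B]].
Arguments inner_torsion {R m M} G D P x v.

(* A linear map from the exterior square of [V] to [W]. *)
Definition alternating_bilinear (R : realType) (V W : lmodType R)
    (b : V -> V -> W) : Prop :=
  [/\ forall u, linear (b u), forall v, linear (b^~ v) & forall u, b u u = 0].

Definition infinitesimally_homogeneous (R : realType) (m : nat)
    (M : manifold R m) (G : set 'M[R]_m) (D : connection M)
    (P : M -> set 'M[R]_m) : Prop :=
  exists (T0 : 'cV[R]_m -> 'cV[R]_m -> 'cV[R]_m)
         (R0 : 'cV[R]_m -> 'cV[R]_m -> 'M[R]_m)
         (I0 : 'cV[R]_m -> set 'M[R]_m),
  [/\ alternating_bilinear T0,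
      alternating_bilinear R0,
      linear_to_quotient (lie_algebra G) I0 &
      forall (x : M) (p : 'M[R]_m), P x p ->
      [/\ forall (u v : 'cV[R]_m) (X Y : vfield M),
            smooth_vfield_near x X -> smooth_vfield_near x Y ->
            X x = p *m u -> Y x = p *m v ->
            torsion D X Y x = p *m T0 u v,
          forall (u v w : 'cV[R]_m) (X Y Z : vfield M),
            smooth_vfield_near x X -> smooth_vfield_near x Y ->
            smooth_vfield_near x Z ->
            X x = p *m u -> Y x = p *m v -> Z x = p *m w ->
            curvature D X Y Z x = p *m (R0 u v *m w) &
          forall u : 'cV[R]_m,
            inner_torsion G D P x (p *m u) = Ad p @` I0 u]].

(** ** Symplectic geometry *)

Definition omega0 (R : realType) (n : nat) (u v : 'cV[R]_(n + n)) : R :=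
  \sum_(i < n) (u (lshift n i) 0 * v (rshift n i) 0
                - u (rshift n i) 0 * v (lshift n i) 0).

Definition Sp (R : realType) (n : nat) : set 'M[R]_(n + n) :=
  [set g | g \in unitmx /\
     forall u v, omega0 (g *m u) (g *m v) = omega0 u v].
Arguments Sp R n : clear implicits.

Definition form2 (R : realType) (m : nat) (M : manifold R m) : Type :=
  forall x : M, tangent x -> tangent x -> R.

Definition form2_eval (R : realType) (m : nat) (M : manifold R m)
    (omega : form2 M) (X Y : vfield M) : M -> R :=
  fun x => omega x (X x) (Y x).

Definition ext_deriv (R : realType) (m : nat) (M : manifold R m)
    (omega : form2 M) (X Y Z : vfield M) (x : M) : R :=
  dfun (form2_eval omega Y Z) x (X x)
  - dfun (form2_eval omega X Z) x (Y x)
  + dfun (form2_eval omega X Y) x (Z x)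
  - form2_eval omega (lie_bracket X Y) Z x
  + form2_eval omega (lie_bracket X Z) Y x
  - form2_eval omega (lie_bracket Y Z) X x.

Definition symplectic_form (R : realType) (m : nat) (M : manifold R m)
    (omega : form2 M) : Prop :=
  [/\ forall x : M,
        @alternating_bilinear R 'cV[R]_m R^o (omega x),
      forall (U : set M) (X Y : vfield M), open U ->
        smooth_vfield_on U X -> smooth_vfield_on U Y ->
        smooth_fun_on U (form2_eval omega X Y),
      forall (x : M) (u : 'cV[R]_m),
        (forall v : 'cV[R]_m, omega x u v = 0) -> u = 0 &
      forall (x : M) (X Y Z : vfield M),
        smooth_vfield_near x X -> smooth_vfield_near x Y ->
        smooth_vfield_near x Z -> ext_deriv omega X Y Z x = 0].

Definition cov_form2 (R : realType) (m : nat) (M : manifold R m)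
    (D : connection M) (omega : form2 M) (X Y Z : vfield M) (x : M) : R :=
  dfun (form2_eval omega Y Z) x (X x)
  - form2_eval omega (cov D X Y) Z x - form2_eval omega Y (cov D X Z) x.

Definition symplectic_connection (R : realType) (m : nat) (M : manifold R m)
    (D : connection M) (omega : form2 M) : Prop :=
  forall (x : M) (X Y Z : vfield M),
    smooth_vfield_near x X -> smooth_vfield_near x Y ->
    smooth_vfield_near x Z -> cov_form2 D omega X Y Z x = 0.

Definition symplectic_frames (R : realType) (n : nat) (M : manifold R (n + n))
    (omega : form2 M) (x : M) : set 'M[R]_(n + n) :=
  [set p | p \in unitmx /\
     forall u v : 'cV[R]_(n + n),
       omega x (p *m u) (p *m v) = omega0 u v].

(* Main.v *)
Require Import Defs.
From HB Require Import structures.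
From mathcomp Require Import all_boot all_order all_algebra.
From mathcomp Require Import all_classical all_reals all_analysis.
From mathcomp Require Import ring lra.

Import Defs.

Set Implicit Arguments.
Unset Strict Implicit.
Unset Printing Implicit Defensive.

Import Order.TTheory GRing.Theory Num.Theory numFieldNormedType.Exports.

Local Open Scope classical_set_scope.
Local Open Scope ring_scope.

(** The matrix [- 1] is symplectic, so with each frame [p] the structure contains
    the frame [- p]. The characteristic tensors [T0] and [I0] have odd degree, and
    the comparison of their values in these two frames gives [T0 = 0] and
    [I0 = 0] ([homogeneous_torsion_free], [homogeneous_Lambda]). The vanishing of
    the inner torsion says that, in the local sections of the structure, the
    matrices of the connection belong to the Lie algebra [sp]; equivalently, the
    [2]-form [omega] for which all these frames are symplectic is parallel
    ([adapted_cov_form2]). For a torsion-free connection the exterior derivative is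
    the alternation of the covariant derivative, and [omega] is closed
    ([ext_deriv_eq0]).

    The curvature has even degree, and the sign of the frame says nothing about
    it. But [omega] being parallel, [R0] takes its values in [sp], and it commutes
    with the symplectic group. Hence [omega0 (R0 u v w) w] is an invariant of
    [u], [v], [w], and it is killed by the symplectic map which doubles [w], halves
    a vector dual to [w] and fixes their common orthogonal: the weight of [w]
    always prevails ([equivariant_curvature_diag]). By polarization [R0 = 0].

    Conversely, when the torsion, the curvature and the covariant derivative of
    [omega] vanish, zero characteristic tensors will do. Two facts have to be
    supplied. Smooth symplectic frames exist locally: the symplectic Gram-Schmidt
    process only uses rational operations, and so preserves smoothness
    ([exists_symplectic_frame]). And the Lie algebra, which is defined by velocities
    of curves, contains all of [sp]: the Cayley transform provides the curves
    ([sp_sub_lie_algebra]).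

    On the analytic side, smooth functions are shown to be closed under the ring
    operations, division and composition, which gives the smoothness of
    inverses of matrix functions and hence of the coefficients of a field in a
    frame. The Leibniz rule for the indicator function of a neighbourhood makes the
    connection local ([nabla_germ]), so that it can be computed in a local frame
    ([nabla_frame]). *)

(** * Calculus of [Ck] functions *)

Section NearEqual.
Variables (R : realType) (V W : normedModType R).
Implicit Types (f g : V -> W) (U : set V).

(** The remainder estimate which characterizes the differential at [x] only
    involves the values of the function near [x]. *)
Lemma near_eq_diff f g x : (\near x, f x = g x) -> differentiable f x ->
  differentiable g x /\ 'd g x = 'd f x :> (V -> W).
Proof.
move=> fg df; have [cdf fE] := (diff_locallyP _ _).1 df.
have fgx : f x = g x := nbhs_singleton fg.
have gE : g \o shift x = cst (g x) + 'd f x +o_ 0 id.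
  apply/eqaddoP => e e0; have /eqaddoP/(_ e e0) := fE.
  have : \forall h \near 0, f (h + x) = g (h + x).
    by move: fg; rewrite (near_shift 0) subr0.
  apply: filterS2 => h /= fgh; rewrite !fctE.
  by rewrite -fgx -fgh.
have dgE := diff_unique cdf gE.
split; last exact: dgE.
by apply: (diff_locallyP _ _).2; rewrite dgE; split; [exact: cdf|exact: gE].
Qed.

Lemma open_near U x (P : V -> Prop) :
  open U -> U x -> (forall y, U y -> P y) -> \forall y \near x, P y.
Proof. by move=> oU Ux UP; apply: filterS (open_nbhs_nbhs (conj oU Ux)). Qed.

(** Functions on a manifold are total but meaningful on open sets only; this
    lemma replaces such a function by any other expression of it on the set. *)
Lemma Ck_eq k U f g : open U -> (forall x, U x -> f x = g x) ->
  Ck k U f -> Ck k U g.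
Proof.
move=> oU; elim: k => [|k IH] in f g * => fg /=.
  move=> cf x Ux; have cfx : f y @[y --> x] --> f x := cf x Ux.
  suff: g y @[y --> x] --> g x by [].
  rewrite -(fg _ Ux); apply: cvg_trans cfx; apply: near_eq_cvg.
  exact: (open_near oU Ux).
move=> [df Df]; split=> [x Ux|v].
  have fgx := open_near oU Ux fg.
  by have [] := near_eq_diff fgx (df x Ux).
apply: IH (Df v) => x Ux; apply: near_eq_derive.
exact: (open_near oU Ux).
Qed.

Lemma Ck_pred k U f : Ck k.+1 U f -> Ck k U f.
Proof.
elim: k => [|k IH] in f * => -[df Df]; last by split=> // v; apply: IH.
by move=> x Ux; apply: differentiable_continuous (df x Ux).
Qed.

Lemma Ck_sub k (U U' : set V) f : U `<=` U' -> Ck k U' f -> Ck k U f.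
Proof.
by move=> UU'; elim: k f => [|k IH] f /= => [cf x /UU'|[df Df]]; [exact: cf|];
  split=> [x /UU'|v]; [exact: df|exact: IH].
Qed.

(** Continuity, differentiability and the functions ['D_v f] are all attached to
    single points. *)
Lemma Ck_local k U f :
  (forall x, U x -> exists2 U', U' x & Ck k U' f) -> Ck k U f.
Proof.
elim: k f => [|k IH] f H; first by move=> x /H[U' U'x]; apply.
split=> [x /H[U' U'x [df _]]|v]; first exact: df.
by apply: IH => x /H[U' U'x [_ Df]]; exists U'; last exact: Df.
Qed.

Lemma Ck_cst k U (w : W) : Ck k U (fun _ => w).
Proof.
elim: k w => [|k IH] w; first by move=> x _; apply: cvg_cst.
split=> [x _|v]; first exact: differentiable_cst.
by rewrite (_ : 'D_v _ = fun=> 0) //; apply/funext => x; rewrite derive_cst.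
Qed.

Lemma smooth_eq U f g : open U -> (forall x, U x -> f x = g x) ->
  smooth_on U f -> smooth_on U g.
Proof. by move=> oU fg sf k; apply: Ck_eq (sf k). Qed.

Lemma smooth_sub (U U' : set V) f :
  U `<=` U' -> smooth_on U' f -> smooth_on U f.
Proof. by move=> UU' sf k; apply: Ck_sub (sf k). Qed.

Lemma smooth_local U f :
  (forall x, U x -> exists2 U', U' x & smooth_on U' f) -> smooth_on U f.
Proof. by move=> H k; apply: Ck_local => x /H[U' U'x sf]; exists U'. Qed.

Lemma smooth_cst U (w : W) : smooth_on U (fun _ => w).
Proof. by move=> k; apply: Ck_cst. Qed.

Lemma smooth_diff U f x : smooth_on U f -> U x -> differentiable f x.
Proof. by move=> sf Ux; have [df _] := sf 1; apply: df. Qed.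

Lemma smooth_derive U f v : smooth_on U f -> smooth_on U ('D_v f).
Proof. by move=> sf k; have [_] := sf k.+1; apply. Qed.

End NearEqual.

Section ScalarFunctions.
Variables (R : realType) (V : normedModType R).
Implicit Types (f g : V -> R) (U : set V).

Lemma Ck_add k U f g : open U -> Ck k U f -> Ck k U g ->
  Ck k U (fun x => f x + g x).
Proof.
move=> oU; elim: k f g => [|k IH] f g /=.
  by move=> cf cg x Ux; apply: cvgD; [exact: cf|exact: cg].
move=> [df Df] [dg Dg]; split=> [x Ux|v].
  exact: differentiableD (df x Ux) (dg x Ux).
apply: Ck_eq (IH _ _ (Df v) (Dg v)) => // x Ux.
by rewrite -deriveD //; apply: diff_derivable; [exact: df|exact: dg].
Qed.

Lemma Ck_mul k U f g : open U -> Ck k U f -> Ck k U g ->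
  Ck k U (fun x => f x * g x).
Proof.
move=> oU; elim: k f g => [|k IH] f g.
  by move=> cf cg x Ux; apply: cvgM; [exact: cf|exact: cg].
move=> cf cg; have [df Df] := cf; have [dg Dg] := cg; split=> [x Ux|v].
  exact: differentiableM (df x Ux) (dg x Ux).
apply: Ck_eq (Ck_add oU (IH _ _ (Ck_pred cf) (Dg v))
                        (IH _ _ (Ck_pred cg) (Df v))) => // x Ux.
by rewrite -[RHS]/('D_v (f * g) x) deriveM //; apply: diff_derivable;
  [exact: df|exact: dg].
Qed.

(** The derivative of [1 / f] is [- (1 / f) * (1 / f) * 'D_v f], a product to
    which the induction hypothesis and the previous lemma apply. *)
Lemma Ck_inv k U f : open U -> (forall x, U x -> f x != 0) -> Ck k U f ->
  Ck k U (fun x => (f x)^-1).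
Proof.
move=> oU f0; elim: k => [|k IH].
  by move=> cf x Ux; apply: cvgV; [exact: f0|exact: cf].
move=> cf; have [df Df] := cf; have IHf := IH (Ck_pred cf).
split=> [x Ux|v]; first exact: differentiableV (df x Ux) (f0 x Ux).
have cN1 : Ck k U (fun _ : V => -1 : R) by exact: Ck_cst.
have H := Ck_mul oU (Ck_mul oU cN1 (Ck_mul oU IHf IHf)) (Df v).
apply: (Ck_eq oU _ H) => x Ux.
rewrite deriveV ?f0 //; last by apply: diff_derivable; exact: df.
by rewrite /GRing.scale /= mulN1r -invfM -expr2.
Qed.

Lemma smooth_add U f g : open U -> smooth_on U f -> smooth_on U g ->
  smooth_on U (fun x => f x + g x).
Proof. by move=> oU sf sg k; apply: Ck_add. Qed.

Lemma smooth_mul U f g : open U -> smooth_on U f -> smooth_on U g ->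
  smooth_on U (fun x => f x * g x).
Proof. by move=> oU sf sg k; apply: Ck_mul. Qed.

Lemma smooth_inv U f : open U -> (forall x, U x -> f x != 0) ->
  smooth_on U f -> smooth_on U (fun x => (f x)^-1).
Proof. by move=> oU f0 sf k; apply: Ck_inv. Qed.

Lemma smooth_opp U f : open U -> smooth_on U f -> smooth_on U (fun x => - f x).
Proof.
move=> oU sf; have cN1 : smooth_on U (fun _ : V => -1 : R) by exact: smooth_cst.
by apply: smooth_eq (smooth_mul oU cN1 sf) => // x _; rewrite mulN1r.
Qed.

Lemma Ck_sum k U I (r : seq I) (F : I -> V -> R) : open U ->
  (forall i, Ck k U (F i)) -> Ck k U (fun x => \sum_(i <- r) F i x).
Proof.
move=> oU cF; rewrite -fct_sumE; elim/big_rec: _ => [|i f _ cf].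
  exact: Ck_cst.
exact: Ck_add (cF i) cf.
Qed.

Lemma smooth_sum U I (r : seq I) (F : I -> V -> R) : open U ->
  (forall i, smooth_on U (F i)) -> smooth_on U (fun x => \sum_(i <- r) F i x).
Proof. by move=> oU sF k; apply: Ck_sum => // i; apply: sF. Qed.

Lemma smooth_prod U I (r : seq I) (F : I -> V -> R) : open U ->
  (forall i, smooth_on U (F i)) -> smooth_on U (fun x => \prod_(i <- r) F i x).
Proof.
move=> oU sF; elim: r => [|i r IH].
  by under eq_fun do rewrite big_nil; exact: smooth_cst.
by under eq_fun do rewrite big_cons; apply: smooth_mul (sF i) IH.
Qed.

End ScalarFunctions.

Section MatrixFunctions.
Variables (R : realType) (V : normedModType R) (m n : nat).
Implicit Types (F : V -> 'M[R]_(m, n)) (U : set V).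

Lemma mx_fun_sum F :
  F = (fun x => \sum_ij F x ij.1 ij.2 *: delta_mx ij.1 ij.2).
Proof.
apply/funext => x; rewrite [LHS]matrix_sum_delta.
by rewrite (pair_bigA _ (fun i j => F x i j *: delta_mx i j)).
Qed.

(** A matrix function is the combination of the constant elementary matrices
    with its entries as coefficients, which reduces it to scalar functions. *)
Lemma mx_differentiable F x :
  differentiable F x <-> forall i j, differentiable (fun y => F y i j) x.
Proof.
split=> [dF i j|dF].
  exact: (differentiable_comp dF (differentiable_coord (F x) i j)).
rewrite (mx_fun_sum F) -fct_sumE; elim/big_rec: _ => [|[i j] G _ dG].
  exact: differentiable_cst.
exact: differentiableD (differentiableZl _ (dF i j)) dG.
Qed.

Lemma mx_derive F x v i j : differentiable F x ->
  'D_v (fun y => F y i j) x = 'D_v F x i j.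
Proof.
move=> dF; rewrite deriveE; last by move: i j; apply/mx_differentiable.
rewrite (diff_comp dF (differentiable_coord (F x) i j)) /=.
have @f : {linear 'M[R]_(m, n) -> R}.
  by exists (fun N : 'M[R]_(_, _) => N i j); do 2![eexists]; do ?[constructor];
     rewrite ?mxE// => ? *; rewrite ?mxE//; move=> ?; rewrite !mxE.
rewrite (@diff_lin _ _ _ f) /=; last exact: matrix_normedtype.coord_continuous.
by rewrite deriveE.
Qed.

Lemma mx_continuous F x :
  {for x, continuous F} <-> forall i j, {for x, continuous (fun y => F y i j)}.
Proof.
split=> [cF i j|cF]; first exact:
  (continuous_comp cF (@matrix_normedtype.coord_continuous _ _ _ i j (F x))).
rewrite (mx_fun_sum F) -fct_sumE; elim/big_rec: _ => [|[i j] G _ cG].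
  exact: cvg_cst.
apply: cvgD cG; apply: cvgZ; [exact: cF|exact: cvg_cst].
Qed.

Lemma Ck_mx k U F :
  open U -> Ck k U F <-> forall i j, Ck k U (fun x => F x i j).
Proof.
move=> oU; elim: k => [|k IH] in F *.
  split=> [cF i j x Ux|cF x Ux].
    by move: i j; apply/mx_continuous; exact: cF.
  by apply/mx_continuous => i j; exact: cF.
split=> [[dF DF] i j|cF].
  split=> [x Ux|v]; first by move: i j; apply/mx_differentiable; exact: dF.
  apply: Ck_eq ((IH _).1 (DF v) i j) => // x Ux.
  by rewrite mx_derive //; exact: dF.
have dF x : U x -> differentiable F x.
  by move=> Ux; apply/mx_differentiable => i j; have [dFij _] := cF i j; exact: dFij.
split=> // v; apply/IH => i j; have [_ DFij] := cF i j.
by apply: Ck_eq (DFij v) => // x Ux; rewrite mx_derive //; exact: dF.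
Qed.

Lemma smooth_mx U F :
  open U -> smooth_on U F <-> forall i j, smooth_on U (fun x => F x i j).
Proof.
move=> oU; split=> [sF i j k|sF k]; first exact: ((Ck_mx _ _ oU).1 (sF k)).
by apply/(Ck_mx _ _ oU) => i j; exact: sF.
Qed.

End MatrixFunctions.

Section MatrixAlgebra.
Variables (R : realType) (V : normedModType R) (U : set V).
Hypothesis oU : open U.

Lemma smooth_mulmx m n p (F : V -> 'M[R]_(m, n)) (G : V -> 'M[R]_(n, p)) :
  smooth_on U F -> smooth_on U G -> smooth_on U (fun x => F x *m G x).
Proof.
move=> /(smooth_mx _ oU) sF /(smooth_mx _ oU) sG; apply/(smooth_mx _ oU) => i j.
under eq_fun do rewrite mxE.
by apply: smooth_sum => // k; apply: smooth_mul.
Qed.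

Lemma smooth_det n (F : V -> 'M[R]_n) :
  smooth_on U F -> smooth_on U (fun x => \det (F x)).
Proof.
move=> /(smooth_mx _ oU) sF; apply: smooth_sum => // s.
apply: smooth_mul => //; first exact: smooth_cst.
by apply: smooth_prod.
Qed.

(** Cramer's rule: the entries of the inverse are polynomials in the entries
    divided by the determinant. *)
Lemma smooth_invmx n (F : V -> 'M[R]_n) :
  (forall x, U x -> F x \in unitmx) ->
  smooth_on U F -> smooth_on U (fun x => invmx (F x)).
Proof.
move=> uF sF; apply: (@smooth_eq _ _ _ _
  (fun x => (\det (F x))^-1 *: \adj (F x))) => // [x Ux|].
  by rewrite /invmx uF.
apply/(smooth_mx _ oU) => i j; under eq_fun do rewrite 2!mxE.
apply: smooth_mul => //.
  apply: smooth_inv => // [x /uF|]; first by rewrite unitmxE unitfE.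
  exact: smooth_det.
apply: smooth_mul => //; first exact: smooth_cst.
apply: smooth_det; apply/(smooth_mx _ oU) => k l.
by under eq_fun do rewrite 2!mxE; exact: ((smooth_mx _ oU).1 sF).
Qed.

End MatrixAlgebra.

Section Composition.
Variables (R : realType) (m : nat).

Lemma cV_sum (w : 'cV[R]_m) : w = \sum_i w i 0 *: delta_mx i 0.
Proof.
by rewrite [LHS]matrix_sum_delta; apply: eq_bigr => i _; rewrite big_ord1.
Qed.

Lemma diff_partial (W : normedModType R) (g : 'cV[R]_m -> W) a w :
  differentiable g a -> 'd g a w = \sum_i w i 0 *: 'D_(delta_mx i 0) g a.
Proof.
move=> dg; rewrite {1}(cV_sum w).
by rewrite linear_sum; apply: eq_bigr => i _; rewrite linearZ deriveE.
Qed.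

Variable V : normedModType R.

(** By the chain rule the derivatives of [g \o phi] are sums of products of the
    components of [phi] with [h \o phi], where [h] is a partial derivative of
    [g]; as [g] has finitely many variables, the induction on [k] closes. *)
Lemma Ck_comp k (U : set V) (U' : set 'cV[R]_m) (phi : V -> 'cV[R]_m)
    (g : 'cV[R]_m -> R) :
  open U -> open U' -> (forall x, U x -> U' (phi x)) ->
  Ck k U phi -> Ck k U' g -> Ck k U (g \o phi).
Proof.
move=> oU oU' phiU; elim: k => [|k IH] in g *.
  move=> cphi cg x Ux.
  exact: (continuous_comp (cphi x Ux) (cg _ (phiU x Ux))).
move=> cphi cg; have [dphi Dphi] := cphi; have [dg Dg] := cg.
split=> [x Ux|v].
  exact: differentiable_comp (dphi x Ux) (dg _ (phiU x Ux)).
have H : Ck k U (fun x =>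
    \sum_i 'D_v phi x i 0 * ('D_(delta_mx i 0) g \o phi) x).
  apply: Ck_sum => // i; apply: Ck_mul => //.
    exact: ((Ck_mx _ _ oU).1 (Dphi v)).
  exact: IH (Ck_pred cphi) (Dg _).
apply: (Ck_eq oU _ H) => x Ux.
rewrite [RHS]deriveE; last exact: differentiable_comp (dphi x Ux) (dg _ (phiU x Ux)).
have dgx := dg _ (phiU x Ux); rewrite (diff_comp (dphi x Ux) dgx) /=.
rewrite (diff_partial _ dgx).
by rewrite -(deriveE v (dphi x Ux)).
Qed.

Lemma smooth_comp (U : set V) (U' : set 'cV[R]_m) (phi : V -> 'cV[R]_m)
    (g : 'cV[R]_m -> R) :
  open U -> open U' -> (forall x, U x -> U' (phi x)) ->
  smooth_on U phi -> smooth_on U' g -> smooth_on U (g \o phi).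
Proof. by move=> oU oU' phiU sphi sg k; apply: Ck_comp (sphi k) (sg k). Qed.

End Composition.

(** * Charts, smooth functions and smooth vector fields *)

Section ChartTopology.
Variables (R : realType) (m : nat) (T : topologicalType) (c : chart R m T).

Lemma open_preimage (S S' : topologicalType) (A : set S) (f : S -> S')
    (B : set S') :
  open A -> open B -> {within A, continuous f} -> open (A `&` f @^-1` B).
Proof.
move=> oA oB; rewrite continuous_open_subspace // => cf.
rewrite openE => x [Ax Bfx]; apply: filterI.
  exact: open_nbhs_nbhs.
apply: cf; first exact: mem_set.
exact: open_nbhs_nbhs.
Qed.

Lemma coord_image (U : set T) :
  coord c @` (dom c `&` U) = coord c @` dom c `&` param c @^-1` U.
Proof.
apply/seteqP; split=> xi.
  by move=> [x [cx Ux] <-]; split; [exists x|rewrite /= coordK].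
by move=> [[x cx <-]]; rewrite /= coordK // => Ux; exists x.
Qed.

Lemma open_coord_image (U : set T) : open U -> open (coord c @` (dom c `&` U)).
Proof.
move=> oU; rewrite coord_image; apply: open_preimage oU (param_continuous (c := c)).
exact: coord_open.
Qed.

Lemma open_coord_preimage (W : set 'cV[R]_m) :
  open W -> open (dom c `&` coord c @^-1` W).
Proof.
move=> oW; apply: open_preimage oW (coord_continuous (c := c)).
exact: dom_open.
Qed.

End ChartTopology.

Section TangentCoord.
Variables (R : realType) (m : nat) (M : manifold R m).
Implicit Types (x y z : M) (U : set M).

Lemma transition_diff x y z : dom (chart_at x) z -> dom (chart_at y) z ->
  differentiable (coord (chart_at y) \o param (chart_at x))
    (coord (chart_at x) z).
Proof.
by move=> xz yz; apply: (smooth_diff (transition_smooth x y)); exists z.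
Qed.

(** The chain rule for a composite of two changes of charts, which agrees near
    [y] with a single change of charts. *)
Lemma tangent_coord_trans x y z (v : tangent y) :
  dom (chart_at x) y -> dom (chart_at z) y ->
  tangent_coord z y v =
  'd (coord (chart_at z) \o param (chart_at x)) (coord (chart_at x) y)
    (tangent_coord x y v).
Proof.
move=> xy zy; rewrite /tangent_coord.
have yy := mem_chart y.
set cx := chart_at x; set cy := chart_at y; set cz := chart_at z.
have d1 := transition_diff yy xy.
have E1 : (coord cx \o param cy) (coord cy y) = coord cx y by rewrite /= coordK.
have d2 : differentiable (coord cz \o param cx)
    ((coord cx \o param cy) (coord cy y)).
  by rewrite E1; exact: transition_diff.
have := diff_comp d1 d2; rewrite E1.
set f := _ \o (_ \o _) => df.
suff [_ E] : differentiable (coord cz \o param cy) (coord cy y) /\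
    'd (coord cz \o param cy) (coord cy y) = 'd f (coord cy y) :> (_ -> _).
  exact: etrans (congr1 (@^~ v) E) (congr1 (@^~ v) df).
apply: near_eq_diff; last exact: differentiable_comp.
apply: (open_near (U := coord cy @` (dom cy `&` dom cx))).
- exact/open_coord_image/dom_open.
- by exists y.
by move=> _ [w [yw xw] <-]; rewrite /f /= !coordK.
Qed.

Lemma tangent_coord_id x (v : tangent x) : tangent_coord x x v = v.
Proof.
rewrite /tangent_coord; set c := chart_at x.
have [_ ->] : differentiable (coord c \o param c) (coord c x) /\
    'd (coord c \o param c) (coord c x) = 'd id (coord c x) :> (_ -> _).
  apply: near_eq_diff; last exact: ex_diff.
  apply: (open_near (U := coord c @` dom c)); first exact: coord_open.
    by exists x => //; exact: mem_chart.
  by move=> _ [w cw <-]; rewrite /= coordK.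
by rewrite diff_val.
Qed.

Definition jacobian z x : 'M[R]_m :=
  \matrix_(i, j) (tangent_coord z x (delta_mx j 0) : 'cV[R]_m) i 0.

Lemma diff_mx (f : 'cV[R]_m -> 'cV[R]_m) a (v : 'cV[R]_m) :
  'd f a v = (\matrix_(i, j) 'd f a (delta_mx j 0) i 0) *m v.
Proof.
rewrite {1}(cV_sum v).
apply/colP => i; rewrite linear_sum summxE mxE; apply: eq_bigr => j _.
by rewrite linearZ !mxE mulrC.
Qed.

Lemma tangent_coordE z x (v : tangent x) :
  tangent_coord z x v = jacobian z x *m (v : 'cV[R]_m).
Proof. exact: diff_mx. Qed.

(** The inverse is the differential of the opposite change of charts. *)
Lemma jacobian_unit z x : dom (chart_at z) x -> jacobian z x \in unitmx.
Proof.
move=> zx; set c := coord (chart_at x) \o param (chart_at z).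
set B := \matrix_(i, j) 'd c (coord (chart_at z) x) (delta_mx j 0) i 0.
suff /mulmx1_unit[] : B *m jacobian z x = 1%:M by [].
have BJ (v : 'cV[R]_m) : B *m jacobian z x *m v = v.
  rewrite -mulmxA -[X in B *m X](tangent_coordE z (v : tangent x)).
  apply: etrans (esym (diff_mx c _ _)) _.
  apply: etrans (esym (tangent_coord_trans _ zx (mem_chart x))) _.
  exact: tangent_coord_id.
apply/matrixP => i j; have /colP/(_ i) := BJ (delta_mx j 0).
by rewrite -colE !mxE eqxx andbT eq_sym.
Qed.

End TangentCoord.

Section SmoothFields.
Variables (R : realType) (m : nat) (M : manifold R m).
Implicit Types (x y z : M) (U : set M) (X Y : vfield M) (f g : M -> R).

Lemma vfield_coordE z X xi :
  vfield_coord z X xi = jacobian z (param (chart_at z) xi) *m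
    (X (param (chart_at z) xi) : 'cV[R]_m).
Proof. exact: tangent_coordE. Qed.

Lemma open_chart_image z U : open U ->
  open (coord (chart_at z) @` (dom (chart_at z) `&` U)).
Proof. exact: open_coord_image. Qed.
Arguments open_chart_image z [U] _.

Lemma chart_image_param z U xi :
  (coord (chart_at z) @` (dom (chart_at z) `&` U)) xi ->
  [/\ dom (chart_at z) (param (chart_at z) xi), U (param (chart_at z) xi) &
      coord (chart_at z) (param (chart_at z) xi) = xi].
Proof. by move=> [y [zy Uy] <-]; rewrite coordK. Qed.

Lemma smooth_transition x z U (g : 'cV[R]_m -> R) :
  open U -> U `<=` dom (chart_at x) ->
  smooth_on (coord (chart_at x) @` (dom (chart_at x) `&` U)) g ->
  smooth_on (coord (chart_at z) @` (dom (chart_at z) `&` U))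
    (g \o (coord (chart_at x) \o param (chart_at z))).
Proof.
move=> oU Ux; apply: smooth_comp; try exact: open_chart_image.
  by move=> xi /chart_image_param[_ Uxi _]; exists (param (chart_at z) xi);
    [split=> //; exact: Ux|].
apply: smooth_sub (transition_smooth z x).
by apply: image_subset => y [zy Uy]; split=> //; exact: Ux.
Qed.

(** Smoothness in a single chart suffices, since the components in two charts
    differ by the smooth Jacobian matrix of a smooth change of charts. *)
Lemma smooth_vfield_chart x U X : open U -> U `<=` dom (chart_at x) ->
  smooth_on (coord (chart_at x) @` (dom (chart_at x) `&` U))
    (vfield_coord x X) ->
  smooth_vfield_on U X.
Proof.
move=> oU Ux sX z; set psi := coord (chart_at x) \o param (chart_at z).
set phi := coord (chart_at z) \o param (chart_at x).
have oz : open (coord (chart_at z) @` (dom (chart_at z) `&` U)).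
  exact: open_chart_image.
have ox : open (coord (chart_at x) @`
    (dom (chart_at x) `&` (dom (chart_at z) `&` U))).
  by apply: open_chart_image; apply: openI oU; exact: dom_open.
apply/(smooth_mx _ oz) => k l; rewrite {l}ord1.
pose G (xi : 'cV[R]_m) := \sum_i vfield_coord x X xi i 0 *
  ('D_(delta_mx i 0) phi xi : 'cV[R]_m) k 0.
apply: (@smooth_eq _ _ _ _ (G \o psi)) => //.
  move=> xi /chart_image_param[zy Uy xiE]; have xy := Ux _ Uy.
  rewrite /vfield_coord (tangent_coord_trans (x := x)) //.
  set y := param (chart_at z) xi in zy Uy xiE xy *.
  have dphi : differentiable phi (coord (chart_at x) y) by exact: transition_diff.
  rewrite (diff_partial _ dphi) summxE; apply: eq_bigr => i _.
  by rewrite mxE /psi /= /vfield_coord coordK.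
have -> : dom (chart_at z) `&` U = dom (chart_at z) `&` (dom (chart_at z) `&` U).
  by rewrite setIA setIid.
apply: smooth_transition.
- by apply: openI oU; exact: dom_open.
- by move=> y [_ /Ux].
apply: smooth_sum => // i; apply: smooth_mul => //.
  apply: ((smooth_mx _ ox).1 _ i 0); apply: smooth_sub sX.
  by apply: image_subset => y [xy [_ Uy]].
apply: ((smooth_mx _ ox).1 _ k 0); apply: smooth_derive.
apply: smooth_sub (transition_smooth x z).
by apply: image_subset => y [xy [zy _]].
Qed.

Lemma smooth_vfieldP U X : open U ->
  smooth_vfield_on U X <->
  forall z i, smooth_on (coord (chart_at z) @` (dom (chart_at z) `&` U))
    (fun xi => vfield_coord z X xi i 0).
Proof.
move=> oU; split=> [sX z i|sX z].
  by have /(smooth_mx _ (open_chart_image z oU)) := sX z.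
by apply/(smooth_mx _ (open_chart_image z oU)) => i j; rewrite ord1.
Qed.

Lemma smooth_fun_cst U (a : R) : smooth_fun_on U (fun _ : M => a).
Proof. by move=> z; apply: smooth_cst. Qed.

Lemma smooth_fun_add U f g : open U -> smooth_fun_on U f ->
  smooth_fun_on U g -> smooth_fun_on U (fun y => f y + g y).
Proof.
by move=> oU sf sg z; apply: smooth_add (sf z) (sg z); exact: open_chart_image.
Qed.

Lemma smooth_fun_mul U f g : open U -> smooth_fun_on U f ->
  smooth_fun_on U g -> smooth_fun_on U (fun y => f y * g y).
Proof.
by move=> oU sf sg z; apply: smooth_mul (sf z) (sg z); exact: open_chart_image.
Qed.

Lemma smooth_fun_eq U f g : open U -> (forall y, U y -> f y = g y) ->
  smooth_fun_on U f -> smooth_fun_on U g.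
Proof.
move=> oU fg sf z; apply: smooth_eq (sf z); first exact: open_chart_image.
by move=> xi /chart_image_param[_ Uxi _] /=; exact: fg.
Qed.

Lemma smooth_fun_sub U U' f : U `<=` U' -> smooth_fun_on U' f ->
  smooth_fun_on U f.
Proof.
by move=> UU' sf z; apply: smooth_sub (sf z); apply: image_subset => y [? /UU'].
Qed.

(** Smoothness near each point gives smoothness on the whole set, so that a
    different local frame may be used near each point. *)
Lemma smooth_fun_local U f :
  (forall x, U x -> smooth_fun_near x f) -> smooth_fun_on U f.
Proof.
move=> H z; apply: smooth_local => xi /chart_image_param[zy Uy xiE].
have [U' [_ U'y] sf] := H _ Uy.
by exists (coord (chart_at z) @` (dom (chart_at z) `&` U'));
  [exists (param (chart_at z) xi)|exact: sf].
Qed.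

Lemma smooth_vfield_sub U U' X : U `<=` U' -> smooth_vfield_on U' X ->
  smooth_vfield_on U X.
Proof.
by move=> UU' sX z; apply: smooth_sub (sX z); apply: image_subset => y [? /UU'].
Qed.

Lemma smooth_vfield_eq U X Y : open U -> (forall y, U y -> X y = Y y) ->
  smooth_vfield_on U X -> smooth_vfield_on U Y.
Proof.
move=> oU XY sX z; apply: smooth_eq (sX z); first exact: open_chart_image.
by move=> xi /chart_image_param[_ Uxi _] /=; rewrite !vfield_coordE XY.
Qed.

Lemma smooth_vfield_scale U f X : open U -> smooth_fun_on U f ->
  smooth_vfield_on U X -> smooth_vfield_on U (fun y => f y *: X y).
Proof.
move=> oU sf /(smooth_vfieldP _ oU) sX; apply/(smooth_vfieldP _ oU) => z i.
apply: smooth_eq (smooth_mul (open_chart_image z oU) (sf z) (sX z i)).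
  exact: open_chart_image.
by move=> xi _; rewrite !vfield_coordE -scalemxAr [RHS]mxE.
Qed.

Lemma smooth_near_common x X Y : smooth_vfield_near x X ->
  smooth_vfield_near x Y ->
  exists U, [/\ open_nbhs x U, smooth_vfield_on U X & smooth_vfield_on U Y].
Proof.
move=> [U oU sX] [U' oU' sY]; exists (U `&` U'); split.
- exact: open_nbhsI.
- exact: smooth_vfield_sub (@subIsetl _ _ _) sX.
- exact: smooth_vfield_sub (@subIsetr _ _ _) sY.
Qed.

End SmoothFields.
Arguments open_chart_image {R m M} z [U] _.

(** * Directional derivatives, connections and frames *)

Section Directional.
Variables (R : realType) (m : nat) (M : manifold R m).
Implicit Types (x y z : M) (U : set M) (f g : M -> R).

Lemma smooth_fun_diff x f : smooth_fun_near x f ->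
  differentiable (f \o param (chart_at x)) (coord (chart_at x) x).
Proof.
move=> [U [_ Ux] sf]; apply: (smooth_diff (sf x)); exists x => //.
by split=> //; exact: mem_chart.
Qed.

Lemma dfun_cst x (v : tangent x) (a : R) : dfun (fun=> a) x v = 0.
Proof. exact: (congr1 (@^~ v) (diff_cst a (coord (chart_at x) x))). Qed.

Lemma dfun_add x (v : tangent x) f g :
  smooth_fun_near x f -> smooth_fun_near x g ->
  dfun (fun y => f y + g y) x v = dfun f x v + dfun g x v.
Proof.
move=> /smooth_fun_diff df /smooth_fun_diff dg.
exact: (congr1 (@^~ v) (diffD df dg)).
Qed.

Lemma dfun_eq x (v : tangent x) U f g : open_nbhs x U ->
  (forall y, U y -> f y = g y) -> smooth_fun_near x f ->
  dfun g x v = dfun f x v.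
Proof.
move=> [oU Ux] fg /smooth_fun_diff df.
have [_ dgE] : differentiable (g \o param (chart_at x)) (coord (chart_at x) x) /\
    'd (g \o param (chart_at x)) (coord (chart_at x) x) =
    'd (f \o param (chart_at x)) (coord (chart_at x) x) :> (_ -> _).
  apply: near_eq_diff df.
  apply: (open_near (U := coord (chart_at x) @` (dom (chart_at x) `&` U))).
  - exact: open_chart_image.
  - by exists x => //; split=> //; exact: mem_chart.
  by move=> xi /chart_image_param[_ Uxi _] /=; exact: fg.
exact: (congr1 (@^~ v) dgE).
Qed.

Lemma smooth_fun_near_common x f g : smooth_fun_near x f ->
  smooth_fun_near x g ->
  exists U, [/\ open_nbhs x U, smooth_fun_on U f & smooth_fun_on U g].
Proof.
move=> [U oU sf] [U' oU' sg]; exists (U `&` U'); split.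
- exact: open_nbhsI.
- exact: smooth_fun_sub (@subIsetl _ _ _) sf.
- exact: smooth_fun_sub (@subIsetr _ _ _) sg.
Qed.

Lemma smooth_near_add x f g : smooth_fun_near x f -> smooth_fun_near x g ->
  smooth_fun_near x (fun y => f y + g y).
Proof.
move=> sf sg; have [U [oU sfU sgU]] := smooth_fun_near_common sf sg.
by exists U => //; apply: smooth_fun_add => //; case: oU.
Qed.

Lemma smooth_near_mul x f g : smooth_fun_near x f -> smooth_fun_near x g ->
  smooth_fun_near x (fun y => f y * g y).
Proof.
move=> sf sg; have [U [oU sfU sgU]] := smooth_fun_near_common sf sg.
by exists U => //; apply: smooth_fun_mul => //; case: oU.
Qed.

Lemma smooth_near_cst x (a : R) : smooth_fun_near x (fun=> a).
Proof. by exists setT; [split=> //; exact: openT|exact: smooth_fun_cst]. Qed.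

Lemma smooth_near_opp x f : smooth_fun_near x f ->
  smooth_fun_near x (fun y => - f y).
Proof.
move=> [U oU sf]; exists U => // z.
by apply: smooth_opp (sf z); apply: open_chart_image; case: oU.
Qed.

Lemma smooth_near_sum x (I : Type) (r : seq I) (F : I -> M -> R) :
  (forall i, smooth_fun_near x (F i)) ->
  smooth_fun_near x (fun y => \sum_(i <- r) F i y).
Proof.
move=> sF; elim: r => [|i r IH].
  by under eq_fun do rewrite big_nil; exact: smooth_near_cst.
by under eq_fun do rewrite big_cons; exact: smooth_near_add.
Qed.

End Directional.

Section Connection.
Variables (R : realType) (m : nat) (M : manifold R m) (D : connection M).
Implicit Types (x y : M) (U : set M) (X Y Z : vfield M).

Lemma smooth_near_eq x U Y Z : open_nbhs x U -> (forall y, U y -> Y y = Z y) ->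
  smooth_vfield_near x Y -> smooth_vfield_near x Z.
Proof.
move=> oU YZ [W oW sY]; exists (U `&` W); first exact: open_nbhsI.
apply: smooth_vfield_eq (smooth_vfield_sub (@subIsetr _ U W) sY).
  by case: oU oW => oU _ [oW _]; exact: openI.
by move=> y [Uy _]; exact: YZ.
Qed.

(** Apply the Leibniz rule to the indicator function of [U], whose differential
    vanishes at [x]. *)
Lemma nabla_germ x (v : tangent x) U Y Z : open_nbhs x U ->
  (forall y, U y -> Y y = Z y) -> smooth_vfield_near x Y ->
  D x v Y = D x v Z.
Proof.
move=> oU YZ sY; have sZ := smooth_near_eq oU YZ sY.
pose chi : M -> R := \1_U.
have chi1 y : U y -> 1 = chi y by move=> Uy; rewrite /chi indicE mem_set.
have schi : smooth_fun_near x chi.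
  exists U => //; apply: (smooth_fun_eq _ chi1); first by case: oU.
  exact: smooth_fun_cst.
have germ T : smooth_vfield_near x T ->
    D x v (fun y => chi y *: (T y : 'cV[R]_m)) = D x v T.
  move=> sT; rewrite nabla_leibniz // (dfun_eq _ oU chi1); last first.
    exact: smooth_near_cst.
  by rewrite dfun_cst scale0r add0r -chi1 ?scale1r //; case: oU.
rewrite -(germ _ sY) -(germ _ sZ); congr (D x v _); apply/funext => y.
rewrite /chi indicE; have [/set_mem/YZ ->//|_] := boolP (y \in U).
by rewrite !scale0r.
Qed.

Lemma smooth_near_scale x (f : M -> R) Y : smooth_fun_near x f ->
  smooth_vfield_near x Y ->
  smooth_vfield_near x (fun y => f y *: (Y y : 'cV[R]_m)).
Proof.
move=> [U oU sf] [W oW sY].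
have oUW := open_nbhsI oU oW; exists (U `&` W) => //.
apply: smooth_vfield_scale; first by case: oUW.
  exact: smooth_fun_sub (@subIsetl _ _ _) sf.
exact: smooth_vfield_sub (@subIsetr _ _ _) sY.
Qed.

Lemma smooth_near_vfield0 x : smooth_vfield_near x (fun _ : M => 0 : 'cV[R]_m).
Proof.
exists setT; first by split=> //; exact: openT.
move=> z; rewrite (_ : vfield_coord z _ = fun=> 0); first exact: smooth_cst.
by apply/funext => xi; rewrite vfield_coordE mulmx0.
Qed.

Lemma smooth_near_addv x Y Z : smooth_vfield_near x Y ->
  smooth_vfield_near x Z ->
  smooth_vfield_near x (fun y => (Y y : 'cV[R]_m) + Z y).
Proof.
move=> sY sZ; have [U [oU sYU sZU]] := smooth_near_common sY sZ.
have oU' : open U by case: oU.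
exists U => // z; have oz := open_chart_image z oU'.
apply/(smooth_mx _ oz) => i j.
apply: smooth_eq (smooth_add oz ((smooth_mx _ oz).1 (sYU z) i j)
  ((smooth_mx _ oz).1 (sZU z) i j)) => // xi _.
by rewrite !vfield_coordE mulmxDr [RHS]mxE.
Qed.

Lemma nabla_zero x (v : tangent x) : D x v (fun _ : M => 0 : 'cV[R]_m) = 0.
Proof.
have := nabla_leibniz D v (smooth_near_cst x 0) (smooth_near_vfield0 x).
rewrite dfun_cst !scale0r addr0 => E; rewrite -[RHS]E; congr (D x v _).
Qed.

Lemma nabla_sum x (v : tangent x) (I : Type) (r : seq I) (f : I -> M -> R)
    (F : I -> vfield M) :
  (forall i, smooth_fun_near x (f i)) ->
  (forall i, smooth_vfield_near x (F i)) ->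
  D x v (fun y => \sum_(i <- r) f i y *: (F i y : 'cV[R]_m)) =
  \sum_(i <- r) (dfun (f i) x v *: (F i x : 'cV[R]_m) + f i x *: D x v (F i)).
Proof.
move=> sf sF.
suff [] : smooth_vfield_near x
    (fun y => \sum_(i <- r) f i y *: (F i y : 'cV[R]_m)) /\
  D x v (fun y => \sum_(i <- r) f i y *: (F i y : 'cV[R]_m)) =
  \sum_(i <- r) (dfun (f i) x v *: (F i x : 'cV[R]_m) + f i x *: D x v (F i)) by [].
elim: r => [|i r [IHs IH]].
  under [X in smooth_vfield_near _ X]eq_fun do rewrite big_nil.
  rewrite big_nil; split; first exact: smooth_near_vfield0.
  by under eq_fun do rewrite big_nil; exact: nabla_zero.
have E : (fun y => \sum_(j <- i :: r) f j y *: (F j y : 'cV[R]_m)) =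
  (fun y => f i y *: (F i y : 'cV[R]_m) +
     \sum_(j <- r) f j y *: (F j y : 'cV[R]_m)).
  by apply/funext => y; rewrite big_cons.
have s1 := smooth_near_scale (sf i) (sF i).
rewrite E; split; first exact: smooth_near_addv.
by rewrite nabla_add // IH nabla_leibniz // big_cons.
Qed.

Definition smooth_frame U (s : M -> 'M[R]_m) : Prop :=
  (forall y, U y -> s y \in unitmx) /\
  (forall w : 'cV[R]_m, smooth_vfield_on U (fun y => s y *m w : tangent y)).

Lemma frame_smooth_coord U s z : open U -> smooth_frame U s ->
  smooth_on (coord (chart_at z) @` (dom (chart_at z) `&` U))
    (fun xi => jacobian z (param (chart_at z) xi) *m s (param (chart_at z) xi)).
Proof.
move=> oU [_ ss]; have oz := open_chart_image z oU.
apply/(smooth_mx _ oz) => i j.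
apply: smooth_eq ((smooth_mx _ oz).1 (ss (delta_mx j 0) z) i 0) => // xi _.
by rewrite vfield_coordE mulmxA -colE mxE.
Qed.

Definition frame_coef (s : M -> 'M[R]_m) X (i : 'I_m) (y : M) : R :=
  (invmx (s y) *m (X y : 'cV[R]_m)) i 0.

(** In a chart the Jacobian matrix cancels between the field and the inverse of
    the frame, which leaves the product of the coordinate expression of the
    field with the inverse of a smooth matrix function. *)
Lemma frame_coef_smooth U s X i : open U -> smooth_frame U s ->
  smooth_vfield_on U X -> smooth_fun_on U (frame_coef s X i).
Proof.
move=> oU sU sX z; have oz := open_chart_image z oU.
set A := coord _ @` _ in oz *.
pose J xi := jacobian z (param (chart_at z) xi) *m s (param (chart_at z) xi).
have sJ : smooth_on A J by exact: frame_smooth_coord.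
have uJ xi : A xi -> J xi \in unitmx.
  move=> /chart_image_param[zy Uy _]; rewrite unitmx_mul jacobian_unit //=.
  by case: sU => us _; exact: us.
have := smooth_mulmx oz (smooth_invmx oz uJ sJ) (sX z).
move=> /(smooth_mx _ oz)/(_ i 0); apply: smooth_eq => // xi Axi.
have [zy Uy _] := chart_image_param Axi.
rewrite /= /frame_coef vfield_coordE; set y := param (chart_at z) xi in zy Uy *.
have uj := jacobian_unit zy; have us : s y \in unitmx by case: sU => us _; exact: us.
congr (fun_of_matrix _ i 0); apply: (can_inj (mulKmx (uJ _ Axi))).
by rewrite mulKVmx ?uJ // /J -/y -mulmxA mulKVmx.
Qed.

Lemma frame_coefE s X y : s y \in unitmx ->
  (X y : 'cV[R]_m) = \sum_i frame_coef s X i y *: (s y *m delta_mx i 0).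
Proof.
move=> us; rewrite -{1}(mulKVmx us (X y : 'cV[R]_m)) {1}(cV_sum (invmx _ *m _)).
by rewrite mulmx_sumr; apply: eq_bigr => i _; rewrite -scalemxAr.
Qed.

Definition dframe_coef s X x (v : tangent x) : 'cV[R]_m :=
  \col_i dfun (frame_coef s X i) x v.

(** Expand [X] in the frame [s] and apply the Leibniz rule to each term: the
    coefficients contribute their derivatives, the fields of the frame
    contribute the matrix [L]. *)
Lemma nabla_frame U s x u L X : open U -> U x -> smooth_frame U s ->
  is_Lambda D s x u L -> smooth_vfield_on U X ->
  D x (s x *m u : tangent x) X =
  s x *m (dframe_coef s X (s x *m u : tangent x) +
          L *m (invmx (s x) *m (X x : 'cV[R]_m))).
Proof.
move=> oU Ux sU sL sX; have [us ss] := sU.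
have oUx : open_nbhs x U by split.
have XE y : U y -> X y = \sum_i frame_coef s X i y *: (s y *m delta_mx i 0).
  by move=> /us; exact: frame_coefE.
rewrite (nabla_germ (s x *m u : tangent x) oUx XE); last by exists U.
rewrite (@nabla_sum _ _ _ _ _ (fun i y => s y *m delta_mx i 0)); first last.
- by move=> i; exists U.
- by move=> i; exists U => //; exact: frame_coef_smooth.
rewrite big_split /= mulmxDr; congr (_ + _).
  rewrite {1}(cV_sum (dframe_coef _ _ _)) mulmx_sumr; apply: eq_bigr => i _.
  by rewrite -scalemxAr mxE.
rewrite {1}(cV_sum (invmx _ *m _)) !mulmx_sumr; apply: eq_bigr => i _.
by rewrite (sL (delta_mx i 0)) -!scalemxAr.
Qed.

(** The Leibniz rule with constant functions makes the covariant derivative of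
    [s w] linear in [w]. *)
Lemma is_Lambda_exists U s x u : open U -> U x -> smooth_frame U s ->
  exists L, is_Lambda D s x u L.
Proof.
move=> oU Ux [us ss]; pose F (j : 'I_m) : vfield M := fun y => s y *m delta_mx j 0.
pose N := \matrix_(i, j) (D x (s x *m u : tangent x) (F j) : 'cV[R]_m) i 0.
exists (invmx (s x) *m N) => w.
rewrite -!mulmxA mulKVmx ?us //.
have -> : (fun y => s y *m w : tangent y) = (fun y => \sum_i w i 0 *: F i y).
  apply/funext => y; rewrite {1}(cV_sum w) mulmx_sumr; apply: eq_bigr => i _.
  by rewrite -scalemxAr.
rewrite (@nabla_sum _ _ _ _ (fun i _ => w i 0) F); first last.
- by move=> i; exists U; [split|exact: ss].
- by move=> i; exact: smooth_near_cst.
under eq_bigr do rewrite dfun_cst scale0r add0r.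
apply/colP => k; rewrite summxE mxE; apply: eq_bigr => i _.
by rewrite !mxE mulrC.
Qed.

End Connection.

(** * The symplectic group and its Lie algebra *)

Section Omega0.
Variables (R : realType) (n : nat).
Local Notation V := 'cV[R]_(n + n).
Implicit Types (u v w f : V) (A B g : 'M[R]_(n + n)) (a b : R).

Lemma omega0_alt u : omega0 u u = 0.
Proof. by rewrite /omega0 big1 // => i _; rewrite mulrC subrr. Qed.

Lemma omega0C u v : omega0 u v = - omega0 v u.
Proof.
by rewrite /omega0 -sumrN; apply: eq_bigr => i _; ring.
Qed.

Lemma omega0_linear u : linear (omega0 u : V -> R^o).
Proof.
move=> a v w; rewrite /omega0 /GRing.scale /= mulr_sumr -big_split.
by apply: eq_bigr => i _; rewrite !mxE /=; ring.
Qed.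

HB.instance Definition _ u :=
  GRing.isLinear.Build R V R^o _ (omega0 u) (omega0_linear u).

Lemma omega0Dr u v w : omega0 u (v + w) = omega0 u v + omega0 u w.
Proof. exact: raddfD. Qed.
Lemma omega0Nr u v : omega0 u (- v) = - omega0 u v.
Proof. exact: raddfN. Qed.
Lemma omega0Zr a u v : omega0 u (a *: v) = a * omega0 u v.
Proof. exact: linearZ. Qed.
Lemma omega00r u : omega0 u 0 = 0.
Proof. exact: raddf0. Qed.
Lemma omega0Dl u v w : omega0 (u + v) w = omega0 u w + omega0 v w.
Proof. by rewrite !(omega0C _ w) omega0Dr opprD. Qed.
Lemma omega0Nl u v : omega0 (- u) v = - omega0 u v.
Proof. by rewrite !(omega0C _ v) omega0Nr. Qed.
Lemma omega0Zl a u v : omega0 (a *: u) v = a * omega0 u v.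
Proof. by rewrite !(omega0C _ v) omega0Zr mulrN. Qed.
Lemma omega00l u : omega0 0 u = 0.
Proof. by rewrite omega0C omega00r oppr0. Qed.

Definition omega0E := (omega0Dl, omega0Dr, omega0Nl, omega0Nr, omega0Zl, omega0Zr).

Lemma omega0_rshift u i : omega0 u (delta_mx (rshift n i) 0) = u (lshift n i) 0.
Proof.
rewrite /omega0 (bigD1 i) //= big1 => [|j ji]; rewrite !mxE !eqxx.
  by rewrite eq_lrshift mulr1 mulr0 subr0 addr0.
by rewrite eq_lrshift (inj_eq (@rshift_inj n n)) (negbTE ji) !mulr0 subr0.
Qed.

Lemma omega0_lshift u i : omega0 u (delta_mx (lshift n i) 0) = - u (rshift n i) 0.
Proof.
rewrite /omega0 (bigD1 i) //= big1 => [|j ji]; rewrite !mxE !eqxx.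
  by rewrite eq_rlshift mulr1 mulr0 add0r addr0.
by rewrite eq_rlshift (inj_eq (@lshift_inj n n)) (negbTE ji) !mulr0 subr0.
Qed.

Lemma omega0_nondeg u : (forall v, omega0 u v = 0) -> u = 0.
Proof.
move=> u0; apply/colP => k; rewrite mxE -(splitK k); case: (fintype.split k) => i /=.
  by rewrite -omega0_rshift u0.
by apply: oppr_inj; rewrite -omega0_lshift u0 oppr0.
Qed.

(** A frame is recognized by its injectivity, which is what a nondegenerate form
    detects. *)
Lemma mx_inj_unit m (g : 'M[R]_m) :
  (forall v : 'cV[R]_m, g *m v = 0 -> v = 0) -> g \in unitmx.
Proof.
move=> inj; rewrite -unitmx_tr -row_free_unit -kermx_eq0.
apply/eqP/row_matrixP => i; rewrite row0.
have : row i (kermx g^T) *m g^T = 0 by rewrite -row_mul mulmx_ker row0.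
by move=> /(congr1 trmx); rewrite trmx_mul trmxK trmx0 => /inj/(congr1 trmx);
  rewrite trmxK trmx0.
Qed.

Lemma omega0_preserving_unit g :
  (forall u v, omega0 (g *m u) (g *m v) = omega0 u v) -> g \in unitmx.
Proof.
move=> gP; apply: mx_inj_unit => v gv; apply: omega0_nondeg => w.
by rewrite -gP gv omega00l.
Qed.

Lemma SpN1 : Sp R n (- 1%:M).
Proof.
have H u v : omega0 (- 1%:M *m u) (- 1%:M *m v) = omega0 u v.
  by rewrite !mulNmx !mul1mx !omega0E opprK.
by split; [exact: omega0_preserving_unit|exact: H].
Qed.

Lemma SpV g : Sp R n g -> Sp R n (invmx g).
Proof.
move=> [ug gP]; split; first by rewrite unitmx_inv.
by move=> u v; rewrite -gP !mulKVmx.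
Qed.

Definition sp : set 'M[R]_(n + n) :=
  [set A | forall u v, omega0 (A *m u) v + omega0 u (A *m v) = 0].

Lemma sp0 : sp 0.
Proof. by move=> u v; rewrite !mul0mx omega00l omega00r addr0. Qed.

Lemma sp_linear a A B : sp A -> sp B -> sp (a *: A + B).
Proof.
move=> sA sB u v; rewrite !mulmxDl -!scalemxAl !omega0E.
by rewrite addrACA -mulrDr sA sB mulr0 addr0.
Qed.

Lemma sp_half A : sp (A + A) -> sp A.
Proof.
move=> sAA; have -> : A = 2^-1 *: (A + A) + 0.
  by rewrite addr0 scalerDr -scalerDl -[2^-1]mul1r -splitr scale1r.
exact: sp_linear sp0.
Qed.

Lemma sp_conj g A : Sp R n g -> sp A -> sp (g *m A *m invmx g).
Proof.
move=> [ug gP] sA u v; have [_ giP] := SpV (conj ug gP).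
have E x : invmx g *m (g *m A *m invmx g *m x) = A *m (invmx g *m x).
  by rewrite -!mulmxA mulKmx.
by rewrite -giP -[X in _ + X]giP !E.
Qed.

Lemma coset_sp A : sp A -> coset sp A = sp.
Proof.
move=> sA; apply/seteqP; split=> B.
  by move=> [C sC <-]; rewrite -[A]scale1r; exact: sp_linear.
move=> sB; exists (B - A); last by rewrite addrC subrK.
by rewrite addrC -scaleN1r; exact: sp_linear.
Qed.

End Omega0.
Arguments sp {R n}.

Section DerivativeRules.
Variables (R : realType) (V : normedModType R).

Lemma derive_big_sum (I : Type) (r : seq I) (h : I -> V -> R) x v :
  (forall i, differentiable (h i) x) ->
  'D_v (fun y => \sum_(i <- r) h i y) x = \sum_(i <- r) 'D_v (h i) x.
Proof.
move=> dh.
suff [_ //] : differentiable (fun y => \sum_(i <- r) h i y) x /\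
  'D_v (fun y => \sum_(i <- r) h i y) x = \sum_(i <- r) 'D_v (h i) x.
elim: r => [|i r [dr IH]].
  under eq_fun do rewrite big_nil.
  by rewrite big_nil; split; [exact: differentiable_cst|exact: derive_cst].
have -> : (fun y => \sum_(j <- i :: r) h j y) =
    h i + (fun y => \sum_(j <- r) h j y) by apply/funext => y; rewrite big_cons.
split; first exact: differentiableD.
by rewrite deriveD ?IH ?big_cons //; exact: diff_derivable.
Qed.

Lemma derive_mul (f g : V -> R) x v : differentiable f x -> differentiable g x ->
  'D_v (fun y => f y * g y) x = f x * 'D_v g x + g x * 'D_v f x.
Proof. by move=> df dg; apply: (@deriveM _ _ f g); apply: diff_derivable. Qed.

Lemma derive_mulmx m n p (F : V -> 'M[R]_(m, n)) (G : V -> 'M[R]_(n, p)) x v :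
  differentiable F x -> differentiable G x ->
  'D_v (fun y => F y *m G y) x = 'D_v F x *m G x + F x *m 'D_v G x.
Proof.
move=> dF dG; have dFij := (mx_differentiable F x).1 dF.
have dGij := (mx_differentiable G x).1 dG.
have dFG k l j : differentiable (fun y => F y k j * G y j l) x.
  exact: differentiableM.
have dM : differentiable (fun y => F y *m G y) x.
  apply/mx_differentiable => i j; under eq_fun do rewrite mxE.
  by rewrite -fct_sumE; apply: differentiable_sum.
apply/matrixP => i j; rewrite -mx_derive //; under eq_fun do rewrite mxE.
rewrite derive_big_sum // !mxE -big_split; apply: eq_bigr => k _.
by rewrite derive_mul // !mx_derive // addrC; congr (_ + _); exact: mulrC.
Qed.

Lemma derive_omega0 n (a b : V -> 'cV[R]_(n + n)) x v :
  differentiable a x -> differentiable b x ->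
  'D_v (fun y => omega0 (a y) (b y)) x =
  omega0 ('D_v a x) (b x) + omega0 (a x) ('D_v b x).
Proof.
move=> da db; have dai i := (mx_differentiable a x).1 da i 0.
have dbi i := (mx_differentiable b x).1 db i 0.
rewrite /omega0 derive_big_sum => [|i]; last first.
  by apply: differentiableB; exact: differentiableM.
rewrite -big_split; apply: eq_bigr => i _ /=.
rewrite (@deriveB _ _ _ (fun y => a y (lshift n i) 0 * b y (rshift n i) 0)
  (fun y => a y (rshift n i) 0 * b y (lshift n i) 0));
  try by apply: diff_derivable; exact: differentiableM.
by rewrite !derive_mul // !mx_derive //; ring.
Qed.

End DerivativeRules.

Section LieAlgebra.
Variables (R : realType) (n : nat).

(** Differentiate the constant function [omega0 (gamma t u) (gamma t v)] at
    [t = 0], where [gamma] is the identity. *)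
Lemma lie_algebra_Sp_sub : lie_algebra (Sp R n) `<=` sp.
Proof.
move=> A [gamma [U [[oU U0] sg gP g0 <-]]] u v.
have dg := smooth_diff sg U0.
have dcst (w : 'cV[R]_(n + n)) : differentiable (fun _ : R => w) 0.
  exact: differentiable_cst.
have dgw (w : 'cV[R]_(n + n)) : differentiable (fun t => gamma t *m w) 0.
  apply: (@smooth_diff _ _ _ U) => //; apply: smooth_mulmx => //.
  exact: smooth_cst.
have Dgw (w : 'cV[R]_(n + n)) :
    'D_1 (fun t => gamma t *m w) 0 = derive1 gamma 0 *m w.
  by rewrite derive_mulmx // derive1E derive_cst mulmx0 addr0.
have : 'D_1 (fun t => omega0 (gamma t *m u) (gamma t *m v)) (0 : R) = 0.
  rewrite -[RHS](derive_cst (omega0 u v) (0 : R) 1).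
  apply: near_eq_derive; apply: (open_near oU U0) => t Ut.
  by have [_] := gP t Ut; apply.
by rewrite derive_omega0 // !Dgw g0 !mul1mx.
Qed.

Lemma smooth_id (U : set R) : smooth_on U (fun t : R => t).
Proof.
case=> [|k]; first by move=> x _; exact: cvg_id.
split=> [x _|v]; first exact: ex_diff.
by rewrite (_ : 'D_v _ = fun=> v); [exact: Ck_cst|];
  apply/funext => x; rewrite derive_id.
Qed.

Lemma smooth_affine m (U : set R) (B : 'M[R]_m) : open U ->
  smooth_on U (fun t : R => 1%:M + t *: B).
Proof.
move=> oU; apply/(smooth_mx _ oU) => i j;
under eq_fun do rewrite 2!mxE [X in _ + X]mxE.
apply: smooth_add => //; first exact: smooth_cst.
by apply: smooth_mul => //; [exact: smooth_id|exact: smooth_cst].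
Qed.

Lemma derive_affine m (B : 'M[R]_m) (t : R) :
  'D_1 (fun t : R => 1%:M + t *: B) t = B.
Proof.
have did : differentiable (fun t : R => t) t by exact: ex_diff.
have dZ : differentiable (fun t : R => t *: B) t by exact: differentiableZl.
rewrite (@deriveD _ _ _ (fun=> 1%:M) (fun t : R => t *: B)); first last.
- exact: diff_derivable.
- exact: derivable_cst.
by rewrite derive_cst add0r deriveE // diffZl // -deriveE // derive_id scale1r.
Qed.

(** The Cayley transform gives the curve: with [B = A / 2], the maps
    [C = 1 - t B] and [C' = 1 + t B] commute and are adjoint to each other for
    [omega0], hence [C^-1 C'] is symplectic; its velocity at [0] is [2 B]. It is
    a rational function of [t], hence smooth near [0]. *)
Lemma sp_sub_lie_algebra : sp `<=` lie_algebra (Sp R n).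
Proof.
move=> A sA; pose B := 2^-1 *: A.
have sB : sp B by rewrite /B -[_ *: _]addr0; exact: sp_linear (@sp0 _ _).
have AB : A = B + B by rewrite /B -scalerDl -[2^-1]mul1r -splitr scale1r.
move: B sB AB => B sB AB.
pose C (t : R) := 1%:M + t *: - B; pose C' (t : R) := 1%:M + t *: B.
pose U := [set t : R | \det (C t) != 0].
have sC V' : open V' -> smooth_on V' C by exact: smooth_affine.
have oU : open U.
  rewrite (_ : U = (fun t => \det (C t)) @^-1` [set x | x != 0]) //.
  apply: open_comp; last exact: open_neq.
  move=> t _; have sd := smooth_det openT (sC _ openT).
  exact: (differentiable_continuous (smooth_diff sd (I : setT t))).
have U0 : U 0 by rewrite /U /= /C scale0r addr0 det1 oner_eq0.
have uC t : U t -> C t \in unitmx by rewrite unitmxE unitfE.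
have sG : smooth_on U (fun t => invmx (C t) *m C' t).
  apply: smooth_mulmx => //; last exact: smooth_affine.
  exact: (smooth_invmx oU uC (sC _ oU)).
have comC t : C t *m C' t = C' t *m C t.
  rewrite /C' mulmxDr mulmxDl mulmx1 mul1mx -scalemxAl -scalemxAr.
  congr (_ + t *: _).
  by rewrite /C mulmxDl mulmxDr mulmx1 mul1mx -scalemxAl -scalemxAr mulmxN mulNmx.
have C'r t u v : omega0 (C' t *m u) v = omega0 u (C t *m v).
  rewrite /C /C' !mulmxDl !mul1mx scalerN mulNmx -!scalemxAl !omega0E.
  by congr (_ + _); rewrite -mulrN; congr (_ * _); apply/eqP; rewrite -addr_eq0 sB.
have gP t : U t -> forall u v,
    omega0 (invmx (C t) *m C' t *m u) (invmx (C t) *m C' t *m v) = omega0 u v.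
  move=> /uC ut u v; rewrite -(mulKVmx ut u) -(mulKVmx ut v).
  set a := invmx _ *m u; set b := invmx _ *m v.
  have E w : invmx (C t) *m C' t *m (C t *m w) = C' t *m w.
    by rewrite -!mulmxA (mulmxA (C' t)) -comC -mulmxA mulKmx.
  rewrite !E C'r mulmxA comC -mulmxA.
  rewrite omega0C C'r -omega0C //.
exists (fun t => invmx (C t) *m C' t), U; split=> //.
- by move=> t Ut; split; [exact: omega0_preserving_unit (gP t Ut)|exact: gP].
- by rewrite /C /C' !scale0r !addr0 mulmx1 invmx1.
rewrite derive1E.
(* The velocity is read off the derivative of [C t *m gamma t = C' t]. *)
have : 'D_1 (fun t => C t *m (invmx (C t) *m C' t)) (0 : R) = B.
  rewrite -[RHS](derive_affine B 0); apply: near_eq_derive.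
  by apply: (open_near oU U0) => t Ut; rewrite mulKVmx ?uC.
rewrite derive_mulmx; last 2 first.
- exact: smooth_diff (sC _ openT) _.
- exact: smooth_diff sG U0.
rewrite derive_affine {1 2 3}/C /C' !scale0r !addr0 invmx1 mul1mx mulmx1 mul1mx.
by move=> /eqP; rewrite addrC subr_eq -AB => /eqP.
Qed.

Lemma lie_algebra_Sp : lie_algebra (Sp R n) = sp.
Proof.
by apply/seteqP; split; [exact: lie_algebra_Sp_sub|exact: sp_sub_lie_algebra].
Qed.

End LieAlgebra.

(** * Equivariant curvature tensors with values in the symplectic Lie algebra *)

Section Alternating.
Variables (R : realType) (V W : lmodType R) (b : V -> V -> W).
Hypothesis bP : alternating_bilinear b.

Lemma altDr u v w : b u (v + w) = b u v + b u w.
Proof. by case: bP => bl _ _; rewrite -[v]scale1r bl !scale1r. Qed.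
Lemma altDl u v w : b (u + v) w = b u w + b v w.
Proof. by case: bP => _ br _; rewrite -[u]scale1r (br w) !scale1r. Qed.
Lemma alt0r u : b u 0 = 0.
Proof. by apply: (addrI (b u 0)); rewrite -altDr !addr0. Qed.
Lemma alt0l u : b 0 u = 0.
Proof. by apply: (addrI (b 0 u)); rewrite -altDl !addr0. Qed.
Lemma altZr a u v : b u (a *: v) = a *: b u v.
Proof. by case: bP => bl _ _; rewrite -[a *: v]addr0 bl alt0r addr0. Qed.
Lemma altZl a u v : b (a *: u) v = a *: b u v.
Proof. by case: bP => _ br _; rewrite -[a *: u]addr0 (br v) alt0l addr0. Qed.
Lemma altNr u v : b u (- v) = - b u v.
Proof. by rewrite -scaleN1r altZr scaleN1r. Qed.
Lemma altNl u v : b (- u) v = - b u v.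
Proof. by rewrite -scaleN1r altZl scaleN1r. Qed.
Lemma altC u v : b u v = - b v u.
Proof.
have [_ _ balt] := bP; apply/eqP; rewrite -addr_eq0.
by have := balt (u + v); rewrite altDl !altDr !balt add0r addr0 => /eqP.
Qed.

End Alternating.

Section EquivariantCurvature.
Variables (R : realType) (n : nat).
Local Notation V := 'cV[R]_(n + n).

(** The hyperbolic rotation with eigenvalue [2] on [w], [1 / 2] on [f] and [1] on
    the orthogonal of both, provided that [omega0 w f = 1]. *)
Definition squeeze (w f : V) : 'M[R]_(n + n) :=
  1%:M + w *m (\row_j omega0 (delta_mx j 0) f)
  - 2^-1 *: (f *m (\row_j omega0 w (delta_mx j 0))).

Lemma squeezeE (w f u : V) :
  squeeze w f *m u = u + omega0 u f *: w - (2^-1 * omega0 w u) *: f.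
Proof.
have row_scal (k : V -> R) : linear (k : V -> R^o) ->
    (\row_j k (delta_mx j 0)) *m u = (k u)%:M.
  move=> lk; pose K : {linear V -> R^o} := HB.pack k
    (GRing.isLinear.Build _ _ _ _ _ lk).
  apply/rowP => j; rewrite !ord1 mxE [RHS]mxE eqxx mulr1n -[k u]/(K u).
  rewrite {2}(cV_sum u) linear_sum; apply: eq_bigr => i _.
  by rewrite linearZ mxE mulrC.
rewrite mulmxDl mulNmx mulmxDl mul1mx -scalemxAl -!mulmxA.
rewrite (row_scal (fun u => omega0 u f)); last first.
  by move=> a x y; rewrite omega0Dl omega0Zl.
rewrite (row_scal (omega0 w)); last exact: omega0_linear.
by rewrite !mul_mx_scalar scalerA.
Qed.

Lemma squeeze_Sp w f : omega0 w f = 1 -> Sp R n (squeeze w f).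
Proof.
move=> wf; have fw : omega0 f w = -1 by rewrite omega0C wf.
have H u v : omega0 (squeeze w f *m u) (squeeze w f *m v) = omega0 u v.
  rewrite !squeezeE !omega0E !omega0_alt wf fw.
  rewrite (omega0C u w) (omega0C f v).
  by set a := omega0 u f; set b := omega0 w u;
     set c := omega0 v f; set d := omega0 w v; field.
by split; [exact: omega0_preserving_unit|].
Qed.

Lemma exists_dual (w : V) : w != 0 -> exists f, omega0 w f = 1.
Proof.
move=> w0; have [v wv] : exists v, omega0 w v != 0.
  apply: contrapT => /forallNP H; move/eqP: w0; apply.
  by apply: omega0_nondeg => v; apply/eqP; apply: contrapT => /negP; exact: H.
by exists ((omega0 w v)^-1 *: v); rewrite omega0Zr mulVf.
Qed.

(** Let [q u v = omega0 (R0 u v *m w) w], with [w] not zero. Invariance under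
    [g = squeeze w f] says that [4 * q (g u) (g v) = q u v], the factor [4] coming
    from the two occurrences of [w]. On eigenvectors [u] and [v] of [g] with
    eigenvalues [k] and [l] this gives [q u v = 0] unless [4 * (k * l) = 1], which
    happens only for [u] and [v] both multiples of [f]; there [q] vanishes because
    it is alternating. The eigenvectors span the whole space. *)
Lemma equivariant_curvature_diag (R0 : V -> V -> 'M[R]_(n + n)) :
  alternating_bilinear R0 ->
  (forall g (u v w : V), Sp R n g ->
     R0 (g *m u) (g *m v) *m (g *m w) = g *m (R0 u v *m w)) ->
  forall u v w, omega0 (R0 u v *m w) w = 0.
Proof.
move=> Rab Req u v w.
have [->|w0] := eqVneq w 0; first by rewrite omega00r.
have [f wf] := exists_dual w0; have fw : omega0 f w = -1 by rewrite omega0C wf.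
pose g := squeeze w f; have gSp : Sp R n g := squeeze_Sp wf.
pose q a b := omega0 (R0 a b *m w) w.
have qDr a b c : q a (b + c) = q a b + q a c.
  by rewrite /q (altDr Rab) mulmxDl omega0Dl.
have qZr k a b : q a (k *: b) = k * q a b.
  by rewrite /q (altZr Rab) -scalemxAl omega0Zl.
have qDl a b c : q (b + c) a = q b a + q c a.
  by rewrite /q (altDl Rab) mulmxDl omega0Dl.
have qZl k a b : q (k *: a) b = k * q a b.
  by rewrite /q (altZl Rab) -scalemxAl omega0Zl.
have qalt a : q a a = 0 by case: Rab => _ _ Ralt; rewrite /q Ralt mul0mx omega00l.
have gw : g *m w = 2 *: w.
  by rewrite squeezeE wf omega0_alt mulr0 scale0r subr0 scale1r -mulr2n scaler_nat.
have gf : g *m f = 2^-1 *: f.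
  rewrite squeezeE wf omega0_alt scale0r addr0 mulr1.
  by rewrite -{1}[f]scale1r -scalerBl; congr (_ *: _); field.
have qg a b : 4 * q (g *m a) (g *m b) = q a b.
  have [_ gP] := gSp; rewrite /q -(gP (R0 a b *m w)) -Req // gw.
  by rewrite -scalemxAr omega0Zl omega0Zr; ring.
have q0 a b k l : g *m a = k *: a -> g *m b = l *: b -> 4 * (k * l) != 1 ->
    q a b = 0.
  move=> ga gb kl; have := qg a b; rewrite ga gb qZl qZr => /eqP.
  rewrite -subr_eq0 !mulrA -[X in _ - X]mul1r -mulrBl mulf_eq0 subr_eq0 -mulrA.
  by rewrite (negbTE kl) => /eqP.
(* The component of [a] in the orthogonal of [w] and [f], fixed by [g]. *)
pose rest a := a - omega0 a f *: w - omega0 w a *: f.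
have restE a : a = rest a + (omega0 a f *: w + omega0 w a *: f).
  by rewrite [X in rest a + X]addrC addrA !subrK.
have grest a : g *m rest a = 1 *: rest a.
  have rf : omega0 (rest a) f = 0.
    by rewrite !omega0E wf omega0_alt mulr1 mulr0 subrr subr0.
  have wr : omega0 w (rest a) = 0.
    by rewrite !omega0E wf omega0_alt mulr1 mulr0 subr0 subrr.
  by rewrite scale1r squeezeE rf wr mulr0 !scale0r addr0 subr0.
move: rest restE grest => rest restE grest.
have n1 : 4 * (2 * 2^-1) != 1 :> R by rewrite mulfV ?pnatr_eq0// mulr1 (eqr_nat _ 4 1).
have n2 : 4 * (2^-1 * 2) != 1 :> R by rewrite mulVf ?pnatr_eq0// mulr1 (eqr_nat _ 4 1).
have n3 : 4 * (1 * 1) != 1 :> R by rewrite !mulr1 (eqr_nat _ 4 1).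
have n4 : 4 * (1 * 2) != 1 :> R by rewrite mul1r -natrM (eqr_nat _ 8 1).
have n5 : 4 * (2 * 1) != 1 :> R by rewrite mulr1 -natrM (eqr_nat _ 8 1).
have E42 : 4 * 2^-1 = 2 :> R by field.
have n6 : 4 * (1 * 2^-1) != 1 :> R by rewrite mul1r E42 (eqr_nat _ 2 1).
have n7 : 4 * (2^-1 * 1) != 1 :> R by rewrite mulr1 E42 (eqr_nat _ 2 1).
rewrite -/(q u v) (restE u) (restE v) !(qDl, qDr, qZl, qZr) !qalt.
rewrite (q0 _ _ _ _ (grest u) (grest v) n3) (q0 _ _ _ _ (grest u) gw n4).
rewrite (q0 _ _ _ _ (grest u) gf n6) (q0 _ _ _ _ gw (grest v) n5).
rewrite (q0 _ _ _ _ gf (grest v) n7) (q0 _ _ _ _ gw gf n1).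
by rewrite (q0 _ _ _ _ gf gw n2) !(mulr0, addr0).
Qed.

(** Since [R0 u v] is in [sp], the form [omega0 (R0 u v *m w) z] is symmetric in
    [w] and [z], and is therefore determined by its values for [w = z]. *)
Lemma equivariant_curvature_eq0 (R0 : V -> V -> 'M[R]_(n + n)) :
  alternating_bilinear R0 -> (forall u v, sp (R0 u v)) ->
  (forall g (u v w : V), Sp R n g ->
     R0 (g *m u) (g *m v) *m (g *m w) = g *m (R0 u v *m w)) ->
  forall u v, R0 u v = 0.
Proof.
move=> Rab Rsp Req u v; have diag := equivariant_curvature_diag Rab Req.
have R0w (w : V) : R0 u v *m w = 0.
  apply: omega0_nondeg => z; have := diag u v (w + z).
  rewrite mulmxDr !omega0E !diag add0r addr0.
  have /eqP := Rsp u v z w; rewrite addr_eq0 => /eqP ->.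
  rewrite (omega0C z) opprK => /eqP; rewrite -mulr2n mulrn_eq0 /= => /eqP //.
apply/matrixP => i j; have /colP/(_ i) := R0w (delta_mx j 0).
by rewrite -colE !mxE.
Qed.

End EquivariantCurvature.

(** * From a homogeneous structure to a flat symplectic manifold *)

Section SymplecticFrames.
Variables (R : realType) (n : nat) (M : manifold R (n + n)) (D : connection M).
Variable omega : form2 M.
Arguments omega : clear implicits.
Local Notation V := 'cV[R]_(n + n).
Implicit Types (x y : M) (U : set M) (X Y Z : vfield M) (s : M -> 'M[R]_(n + n)).

Lemma smooth_omega0 U (a b : M -> V) : open U ->
  (forall i, smooth_fun_on U (fun y => a y i 0)) ->
  (forall i, smooth_fun_on U (fun y => b y i 0)) ->
  smooth_fun_on U (fun y => omega0 (a y) (b y)).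
Proof.
move=> oU sa sb z; apply: (smooth_sum _ (open_chart_image z oU)) => i.
have oz := open_chart_image z oU.
have sp1 := smooth_mul oz (sa (lshift n i) z) (sb (rshift n i) z).
have sp2 := smooth_mul oz (sa (rshift n i) z) (sb (lshift n i) z).
exact: (smooth_add oz sp1 (smooth_opp oz sp2)).
Qed.

(** The Leibniz rule for the bilinear form [omega0]. *)
Lemma dfun_omega0 x (v : tangent x) (a b : M -> V) :
  (forall i, smooth_fun_near x (fun y => a y i 0)) ->
  (forall i, smooth_fun_near x (fun y => b y i 0)) ->
  dfun (fun y => omega0 (a y) (b y)) x v =
  omega0 (\col_i dfun (fun y => a y i 0) x v) (b x) +
  omega0 (a x) (\col_i dfun (fun y => b y i 0) x v).
Proof.
move=> sa sb; set c := chart_at x.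
have dai i := smooth_fun_diff (sa i); have dbi i := smooth_fun_diff (sb i).
have da : differentiable (a \o param c) (coord c x).
  by apply/mx_differentiable => i j; rewrite ord1; exact: dai.
have db : differentiable (b \o param c) (coord c x).
  by apply/mx_differentiable => i j; rewrite ord1; exact: dbi.
have dab : differentiable (fun xi => omega0 ((a \o param c) xi) ((b \o param c) xi))
    (coord c x).
  have -> : (fun xi => omega0 ((a \o param c) xi) ((b \o param c) xi)) =
    (fun y => omega0 (a y) (b y)) \o param c by [].
  apply: smooth_fun_diff; rewrite /omega0; apply: smooth_near_sum => i.
  by apply: smooth_near_add; [|apply: smooth_near_opp]; exact: smooth_near_mul.
have := derive_omega0 v da db; rewrite [LHS]deriveE // => E.
rewrite /dfun; apply: etrans E _.
have xx : param c (coord c x) = x by rewrite coordK //; exact: mem_chart.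
rewrite /= xx; congr (_ + _); [congr (omega0 _ _)|congr (omega0 _ _)];
  apply/colP => i.
  by rewrite [RHS]mxE -(mx_derive _ _ _ da) deriveE //; exact: dai.
by rewrite [RHS]mxE -(mx_derive _ _ _ db) deriveE //; exact: dbi.
Qed.

Definition adapted_frame U s : Prop :=
  smooth_frame U s /\
  forall y (a b : V), U y -> omega y (s y *m a) (s y *m b) = omega0 a b.

Lemma adapted_omegaE U s y (a b : tangent y) : adapted_frame U s -> U y ->
  omega y a b = omega0 (invmx (s y) *m (a : V)) (invmx (s y) *m (b : V)).
Proof. by move=> [[us _] so] Uy; rewrite -(so y) // !mulKVmx // us. Qed.

Lemma adapted_form_smooth U s Y Z : open U -> adapted_frame U s ->
  smooth_vfield_on U Y -> smooth_vfield_on U Z ->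
  smooth_fun_on U (form2_eval omega Y Z).
Proof.
move=> oU sU sY sZ; have [ss _] := sU.
pose f y := omega0 (invmx (s y) *m (Y y : V)) (invmx (s y) *m (Z y : V)).
apply: (@smooth_fun_eq _ _ _ _ f) => //.
  by move=> y Uy; rewrite /form2_eval (adapted_omegaE _ _ sU).
by apply: smooth_omega0 => // i; apply: frame_coef_smooth.
Qed.

(** In an adapted frame [omega] is constant, so that its covariant derivative is
    the action of the matrix of the connection on the standard form. *)
Lemma adapted_cov_form2 U s x u L X Y Z : open U -> U x ->
  adapted_frame U s -> is_Lambda D s x u L -> sp L -> (X x : V) = s x *m u ->
  smooth_vfield_on U Y -> smooth_vfield_on U Z ->
  cov_form2 D omega X Y Z x = 0.
Proof.
move=> oU Ux sU sL Lsp Xx sY sZ; have [ss _] := sU.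
have us : s x \in unitmx by case: ss => us _; exact: us.
have oUx : open_nbhs x U by [].
have sc T i : smooth_vfield_on U T -> smooth_fun_near x (frame_coef s T i).
  by move=> sT; exists U => //; exact: frame_coef_smooth.
pose c T y : V := invmx (s y) *m (T y : V).
have cov_c T : smooth_vfield_on U T ->
    invmx (s x) *m (cov D X T x : V) = dframe_coef s T (X x) + L *m c T x.
  by move=> sT; rewrite /cov Xx (nabla_frame oU Ux ss sL sT) mulKmx.
rewrite /cov_form2 /form2_eval !(adapted_omegaE _ _ sU Ux).
rewrite (@dfun_eq _ _ _ x (X x) U (fun y => omega0 (c Y y) (c Z y))) //; first last.
- exists U => //; apply: smooth_omega0 => // i.
    exact: (frame_coef_smooth i oU ss sY).
  exact: (frame_coef_smooth i oU ss sZ).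
- by move=> y Uy; rewrite /form2_eval (adapted_omegaE _ _ sU).
rewrite dfun_omega0; [|by move=> i; exact: sc..].
rewrite !cov_c // !omega0E -/(c Y x) -/(c Z x).
rewrite -/(dframe_coef s Y (X x)) -/(dframe_coef s Z (X x)).
have /eqP := Lsp (c Y x) (c Z x); rewrite addr_eq0 => /eqP ->; ring.
Qed.

(** Torsion-freeness expresses the brackets by covariant derivatives, and
    [omega] being parallel expresses the derivatives of its values likewise; the
    twelve resulting terms cancel in pairs by antisymmetry. *)
Lemma ext_deriv_eq0 x X Y Z :
  @alternating_bilinear R V R^o (omega x) ->
  torsion_free D -> symplectic_connection D omega ->
  smooth_vfield_near x X -> smooth_vfield_near x Y -> smooth_vfield_near x Z ->
  ext_deriv omega X Y Z x = 0.
Proof.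
move=> wab tf sc sX sY sZ.
have wDr (a b c : V) : omega x a (b - c) = omega x a b - omega x a c.
  by rewrite (altDr wab) (altNr wab).
have wDl (a b c : V) : omega x (b - c) a = omega x b a - omega x c a.
  by rewrite (altDl wab) (altNl wab).
have wC (a b : V) : omega x a b = - omega x b a := altC wab a b.
have br A B : smooth_vfield_near x A -> smooth_vfield_near x B ->
    (lie_bracket A B x : V) = cov D A B x - cov D B A x.
  by move=> sA sB; have /eqP := tf x A B sA sB; rewrite subr_eq0 => /eqP.
have dw A B C : smooth_vfield_near x A -> smooth_vfield_near x B ->
    smooth_vfield_near x C -> dfun (form2_eval omega B C) x (A x) =
    omega x (cov D A B x) (C x) + omega x (B x) (cov D A C x).
  move=> sA sB sC; have /eqP := sc x A B C sA sB sC.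
  by rewrite /cov_form2 -addrA -opprD subr_eq0 => /eqP.
rewrite /ext_deriv !dw // /form2_eval !br // !wDl.
rewrite (wC (cov D X Z x)) (wC (cov D Y Z x)) (wC (cov D Z Y x)) (wC (cov D Z X x)).
ring.
Qed.

End SymplecticFrames.

Section Forward.
Variables (R : realType) (n : nat) (M : manifold R (n + n)) (D : connection M).
Variable P : M -> set 'M[R]_(n + n).
Local Notation V := 'cV[R]_(n + n).
Implicit Types (x y : M) (U : set M) (X Y Z : vfield M) (s : M -> 'M[R]_(n + n)).
Hypothesis GP : G_structure (Sp R n) P.

Lemma frame_mul x p g : P x p -> Sp R n g -> P x (p *m g).
Proof. by case: GP => _ H _ Pp gSp; rewrite (H x p Pp); exists g. Qed.

(** The pull-back of the standard form by the inverse of a frame. Two frames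
    differ by a symplectic matrix, so an arbitrary one can be chosen; the default
    value [0] is never taken, since [P x] is not empty. *)
Definition structure_form : form2 M := fun x u v =>
  let p := xget 0 (P x) in omega0 (invmx p *m (u : V)) (invmx p *m (v : V)).

Lemma structure_formE x p (a b : V) : P x p ->
  structure_form (x := x) (p *m a) (p *m b) = omega0 a b.
Proof.
move=> Pp; rewrite /structure_form; set q := xget 0 (P x).
have Pq : P x q by exact: xgetI Pp.
case: GP => uP H _; move: Pp; rewrite (H x q Pq) => -[g [_ gP] <-].
by rewrite -!mulmxA !mulKmx ?(uP x) ?gP.
Qed.

Lemma structure_adapted U s : local_section P U s ->
  adapted_frame structure_form U s.
Proof.
move=> [Ps ss]; case: GP => uP _ _; split; first by split=> // y /Ps/uP.
by move=> y a b Uy; apply: structure_formE; exact: Ps.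
Qed.

Lemma structure_form_alt x :
  @alternating_bilinear R V R^o (structure_form (x := x)).
Proof.
split=> [u a v w|u a v w|u]; rewrite /structure_form.
- by rewrite mulmxDr -scalemxAr omega0Dr omega0Zr.
- by rewrite mulmxDr -scalemxAr omega0Dl omega0Zl.
exact: omega0_alt.
Qed.

Lemma exists_section x : exists U s, [/\ open U, U x & local_section P U s].
Proof. by case: GP => _ _ /(_ x)[s [U [[oU Ux] sU]]]; exists U, s. Qed.

Lemma structure_frames x : P x = symplectic_frames structure_form x.
Proof.
have [U [s [oU Ux [Ps _]]]] := exists_section x; have Psx := Ps x Ux.
case: GP => uP H _; have us := uP x _ Psx.
apply/seteqP; split=> p.
  by move=> Pp; split=> [|u v]; [exact: uP Pp|exact: structure_formE].
move=> [up pP]; rewrite (H x _ Psx); exists (invmx (s x) *m p); last first.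
  by rewrite mulKVmx.
split=> [|u v]; first by rewrite unitmx_mul unitmx_inv us.
by rewrite -(structure_formE _ _ Psx) !mulmxA !mulmxV // !mul1mx pP.
Qed.

Section Homogeneous.
Variables (T0 : V -> V -> V) (R0 : V -> V -> 'M[R]_(n + n)).
Variable I0 : V -> set 'M[R]_(n + n).
Hypotheses (T0ab : alternating_bilinear T0) (R0ab : alternating_bilinear R0).
Hypothesis I0q : linear_to_quotient (lie_algebra (Sp R n)) I0.
Hypothesis tors : forall x p, P x p -> forall (u v : V) X Y,
  smooth_vfield_near x X -> smooth_vfield_near x Y ->
  (X x : V) = p *m u -> (Y x : V) = p *m v -> torsion D X Y x = p *m T0 u v.
Hypothesis curv : forall x p, P x p -> forall (u v w : V) X Y Z,
  smooth_vfield_near x X -> smooth_vfield_near x Y -> smooth_vfield_near x Z ->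
  (X x : V) = p *m u -> (Y x : V) = p *m v -> (Z x : V) = p *m w ->
  curvature D X Y Z x = p *m (R0 u v *m w).
Hypothesis inner : forall x p, P x p -> forall u : V,
  inner_torsion (Sp R n) D P x (p *m u) = Ad p @` I0 u.

Lemma frame_opp x p : P x p -> P x (- p).
Proof.
by move=> Pp; have := frame_mul Pp (@SpN1 R n); rewrite mulmxN mulmx1.
Qed.

(** Passing from the frame [p] to [- p] changes the signs of both arguments of
    [T0] and of its value: three signs in all, so [torsion = - torsion]. *)
Lemma homogeneous_torsion_free : torsion_free D.
Proof.
move=> x X Y sX sY; have [U [s [oU Ux [Ps _]]]] := exists_section x.
have Psx := Ps x Ux; have us : s x \in unitmx by case: GP => uP _ _; exact: uP Psx.
set u := invmx (s x) *m (X x : V); set v := invmx (s x) *m (Y x : V).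
have E1 : torsion D X Y x = s x *m T0 u v.
  by apply: tors => //; rewrite mulKVmx.
have E2 : torsion D X Y x = - s x *m T0 u v.
  rewrite -[T0 u v]opprK -(altNl T0ab) -(altNr T0ab).
  by apply: tors (frame_opp Psx) _ _ _ _ _ _ _ _ => //;
    rewrite mulmxN mulNmx opprK mulKVmx.
have /eqP : torsion D X Y x = - torsion D X Y x by rewrite {1}E2 E1 mulNmx.
by rewrite -subr_eq0 opprK -mulr2n -scaler_nat scaler_eq0 pnatr_eq0 => /eqP.
Qed.

Lemma Ad_inj p : p \in unitmx -> injective (@Ad R (n + n) p).
Proof.
move=> up A B /(congr1 (fun C => invmx p *m C *m p)).
by rewrite /Ad !mulmxA !mulVmx // !mul1mx -!mulmxA !mulVmx // !mulmx1.
Qed.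

(** Conjugation by [p] and by [- p] coincide, so comparing the two frames shows
    that the coset of [L] is both [I0 u] and [I0 (- u)], which are opposite to
    each other. Hence [L + L] is in [sp]. *)
Lemma homogeneous_Lambda U s x u L : open U -> U x -> local_section P U s ->
  is_Lambda D s x u L -> sp L.
Proof.
move=> oU Ux [Ps ss] sL; have Psx := Ps x Ux.
have us : s x \in unitmx by case: GP => uP _ _; exact: uP Psx.
have LI : inner_torsion (Sp R n) D P x (s x *m u) (Ad (s x) L).
  exists s, U, u, L; split=> //; exists L => //; exists 0; last by rewrite addr0.
  by rewrite lie_algebra_Sp; exact: sp0.
have AdN B : Ad (- s x) B = Ad (s x) B.
  have uN : -1 *: s x \in unitmx.
    by case: GP => uP _ _; rewrite scaleN1r (uP x) //; exact: frame_opp.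
  by rewrite /Ad -scaleN1r invmxZ // invrN1 !scaleN1r mulNmx mulmxN mulNmx opprK.
have L1 : I0 u L.
  by move: LI; rewrite (inner Psx) => -[B IB /(Ad_inj us) <-].
have L2 : I0 (- u) L.
  move: LI; rewrite -[s x *m u]opprK -mulmxN -mulNmx (inner (frame_opp Psx)).
  by move=> -[B IB]; rewrite AdN => /(Ad_inj us) <-.
have [Ic Il] := I0q; have [A IA] := Ic u.
have I00 : I0 0 = coset (lie_algebra (Sp R n)) 0.
  have := Il (-1) u u A A IA IA; rewrite !scaleN1r !addNr.
  exact.
have := Il (-1) u 0 A 0 IA I00; rewrite !addr0 !scaleN1r => INA.
move: L1 L2; rewrite IA INA lie_algebra_Sp => -[B1 s1 E1] [B2 s2 E2].
apply: sp_half; rewrite -{1}E1 -E2 addrACA subrr add0r -[B1]scale1r.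
exact: sp_linear.
Qed.

(** The matrices of the connection in local sections of the structure are in
    [sp], that is to say they annihilate [omega0]. *)
Lemma structure_symplectic_connection : symplectic_connection D structure_form.
Proof.
move=> x X Y Z sX [W [oW Wx] sY] [W' [oW' W'x] sZ].
have [U [s [oU Ux sU]]] := exists_section x.
pose U' := U `&` (W `&` W').
have oU' : open U' by apply: openI oU (openI oW oW').
have U'U : U' `<=` U by move=> y [].
have sU' : local_section P U' s.
  by case: sU => Ps ss; split=> [y /U'U/Ps //|w]; apply: smooth_vfield_sub (ss w).
have ad := structure_adapted sU'.
have [sf _] := ad; have U'x : U' x by [].
have us : s x \in unitmx by case: sf => us _; exact: us.
have [L sL] := is_Lambda_exists D (invmx (s x) *m (X x : V)) oU' U'x sf.
apply: (adapted_cov_form2 oU' U'x ad sL).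
- exact: homogeneous_Lambda sU' sL.
- by rewrite mulKVmx.
- by apply: smooth_vfield_sub sY => y [_ []].
- by apply: smooth_vfield_sub sZ => y [_ []].
Qed.

Lemma structure_form_smooth U X Y : open U -> smooth_vfield_on U X ->
  smooth_vfield_on U Y -> smooth_fun_on U (form2_eval structure_form X Y).
Proof.
move=> oU sX sY; apply: smooth_fun_local => x Ux.
have [W [s [oW Wx [Ps ss]]]] := exists_section x.
have oUW : open (U `&` W) by exact: openI.
exists (U `&` W) => //; apply: (adapted_form_smooth (s := s)) => //.
- apply: structure_adapted; split=> [y [_ /Ps] //|w].
  by apply: smooth_vfield_sub (ss w) => y [].
- by apply: smooth_vfield_sub sX => y [].
by apply: smooth_vfield_sub sY => y [].
Qed.

Lemma structure_symplectic_form : symplectic_form structure_form.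
Proof.
split.
- exact: structure_form_alt.
- exact: structure_form_smooth.
- move=> x u uv; have [U [s [oU Ux [Ps _]]]] := exists_section x.
  have Psx := Ps x Ux; have us : s x \in unitmx by case: GP => uP _ _; exact: uP Psx.
  suff H : invmx (s x) *m u = 0 by rewrite -(mulKVmx us u) H mulmx0.
  by apply: omega0_nondeg => v; rewrite -(structure_formE _ _ Psx) mulKVmx.
move=> x X Y Z; apply: ext_deriv_eq0.
- exact: structure_form_alt.
- exact: homogeneous_torsion_free.
- exact: structure_symplectic_connection.
Qed.

(** The functions [omega (s w, s z)] are constant for a section [s]. Differentiate
    them along [Y] and then along [X], using that [omega] is parallel; after
    antisymmetrization in [X] and [Y] the mixed terms cancel, and what remains is
    that the curvature is skew for [omega]. Working with constant functions
    avoids the symmetry of second derivatives. *)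
Lemma homogeneous_curvature_sp x u v : sp (R0 u v).
Proof.
have [U [s [oU Ux sU]]] := exists_section x; have [Ps ss] := sU.
have Psx := Ps x Ux; have oUx : open_nbhs x U by [].
have ad := structure_adapted sU; have [[us _] adE] := ad.
pose S (w : V) : vfield M := fun y => s y *m w.
have sS w : smooth_vfield_on U (S w) by exact: ss.
pose om y (a b : V) := structure_form (x := y) a b.
have omDr y a b c : om y a (b - c) = om y a b - om y a c.
  by rewrite /om /structure_form mulmxBr omega0Dr omega0Nr.
have omDl y a b c : om y (b - c) a = om y b a - om y c a.
  by rewrite /om /structure_form mulmxBr omega0Dl omega0Nl.
(* The first derivative of the constant [omega (s w, s z)], in any direction. *)
have skew y (E : tangent y) w z : U y ->
    om y (D y E (S w)) (S z y) + om y (S w y) (D y E (S z)) = 0.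
  move=> Uy; pose X := S (invmx (s y) *m (E : V)).
  have XE : X y = E by rewrite /X /S mulKVmx // us.
  have nU : open_nbhs y U by [].
  have := structure_symplectic_connection (x := y) (X := X) (Y := S w) (Z := S z)
    (ex_intro2 _ _ U nU (sS _)) (ex_intro2 _ _ U nU (sS _)) (ex_intro2 _ _ U nU (sS _)).
  rewrite /cov_form2 /form2_eval /cov XE.
  rewrite (@dfun_eq _ _ _ y E U (fun=> omega0 w z)) //; last exact: smooth_near_cst.
    by rewrite dfun_cst sub0r -opprD => /eqP; rewrite oppr_eq0 => /eqP.
  by move=> y' Uy'; rewrite /S adE.
(* The derivative along [S a] of the first derivative along [S b]. *)
have second a b w z :
    om x (cov D (S a) (cov D (S b) (S w)) x) (S z x)
    + om x (cov D (S b) (S w) x) (cov D (S a) (S z) x)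
    + (om x (cov D (S a) (S w) x) (cov D (S b) (S z) x)
    + om x (S w x) (cov D (S a) (cov D (S b) (S z)) x)) = 0.
  have nS c : smooth_vfield_near x (S c) by exists U.
  have sDS c d : smooth_vfield_on U (cov D (S c) (S d)) by exact: nabla_smooth.
  have nDS c d : smooth_vfield_near x (cov D (S c) (S d)) by exists U.
  have /eqP := structure_symplectic_connection (nS a) (nDS b w) (nS z).
  rewrite /cov_form2 -addrA -opprD subr_eq0 => /eqP E1.
  have /eqP := structure_symplectic_connection (nS a) (nS w) (nDS b z).
  rewrite /cov_form2 -addrA -opprD subr_eq0 => /eqP E2.
  rewrite -[X in X + _]E1 -[X in _ + X]E2 -dfun_add; first last.
  - by exists U => //; apply: structure_form_smooth.
  - by exists U => //; apply: structure_form_smooth.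
  rewrite (@dfun_eq _ _ _ x (S a x) U (fun=> 0)) ?dfun_cst //; last first.
    exact: smooth_near_cst.
  by move=> y Uy; rewrite -(skew y (S b y) w z Uy).
have curvE w : curvature D (S u) (S v) (S w) x = s x *m (R0 u v *m w).
  by apply: curv => //; exists U.
move=> w z; rewrite -!(structure_formE _ _ Psx) -!curvE -/(om x _ _) -/(om x _ _).
rewrite -/(S z x) -/(S w x) /curvature !omDl !omDr.
have := skew x (lie_bracket (S u) (S v) x) w z Ux.
have := second u v w z; have := second v u w z.
rewrite /cov; lra.
Qed.

(** Evaluate the curvature on the same three fields in the frames [s x] and
    [s x *m g]. *)
Lemma homogeneous_curvature_equivariant x g (u v w : V) : Sp R n g ->
  R0 (g *m u) (g *m v) *m (g *m w) = g *m (R0 u v *m w).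
Proof.
move=> gSp; have [U [s [oU Ux [Ps ss]]]] := exists_section x.
have Psx := Ps x Ux; have us : s x \in unitmx by case: GP => uP _ _; exact: uP Psx.
pose S (a : V) : vfield M := fun y => s y *m (g *m a).
have sS a : smooth_vfield_near x (S a) by exists U => //; exact: ss.
have E1 := curv Psx (sS u) (sS v) (sS w) erefl erefl erefl.
have Sg a : (S a x : V) = s x *m g *m a by rewrite -mulmxA.
have E2 := curv (frame_mul Psx gSp) (sS u) (sS v) (sS w) (Sg _) (Sg _) (Sg _).
apply: (can_inj (mulKmx us)).
by rewrite -[LHS]E1 [LHS]E2 -[LHS]mulmxA.
Qed.

Lemma homogeneous_flat : flat D.
Proof.
move=> x X Y Z sX sY sZ; have [U [s [oU Ux [Ps _]]]] := exists_section x.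
have Psx := Ps x Ux; have us : s x \in unitmx by case: GP => uP _ _; exact: uP Psx.
have XE (a : V) : a = s x *m (invmx (s x) *m a) by rewrite mulKVmx.
rewrite (curv Psx sX sY sZ (XE _) (XE _) (XE _)) equivariant_curvature_eq0 //.
- by rewrite mul0mx mulmx0.
- by move=> u v; exact: homogeneous_curvature_sp x u v.
- by move=> g u v w; exact: homogeneous_curvature_equivariant x g u v w.
Qed.

End Homogeneous.
End Forward.

Lemma homogeneous_symplectic (R : realType) (n : nat) (M : manifold R (n + n))
    (D : connection M) (P : M -> set 'M[R]_(n + n)) :
  G_structure (Sp R n) P -> infinitesimally_homogeneous (Sp R n) D P ->
  exists omega : form2 M,
    [/\ symplectic_form omega, (forall x : M, P x = symplectic_frames omega x),
        torsion_free D, flat D & symplectic_connection D omega].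
Proof.
move=> GP [T0 [R0 [I0 [T0ab R0ab I0q H]]]]; exists (structure_form P).
have tors x p (Px : P x p) := let: And3 t _ _ := H x p Px in t.
have curv x p (Px : P x p) := let: And3 _ c _ := H x p Px in c.
have inner x p (Px : P x p) := let: And3 _ _ i := H x p Px in i.
split.
- exact: (structure_symplectic_form GP T0ab I0q tors inner).
- exact: structure_frames.
- exact: (homogeneous_torsion_free GP T0ab tors).
- exact: (homogeneous_flat GP R0ab I0q curv inner).
- exact: (structure_symplectic_connection GP I0q inner).
Qed.

(** * Local symplectic frames *)

Section BilinearExpansion.
Variables (R : realType) (m : nat).
Local Notation V := 'cV[R]_m.

Lemma bilinear_expand (b : V -> V -> R^o) u v : alternating_bilinear b ->
  b u v = \sum_i \sum_j u i 0 * v j 0 * b (delta_mx i 0) (delta_mx j 0).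
Proof.
move=> bP; rewrite {1}(cV_sum u).
rewrite (big_morph (fun u => b u v) (fun x y => altDl bP x y v) (alt0l bP v)).
apply: eq_bigr => i _; rewrite {1}(cV_sum v) (altZl bP).
rewrite (big_morph (b _) (altDr bP _) (alt0r bP _)) scaler_sumr.
by apply: eq_bigr => j _; rewrite (altZr bP) scalerA.
Qed.

End BilinearExpansion.

Section SmoothGramSchmidt.
Variables (R : realType) (n : nat) (E : normedModType R).
Local Notation V := 'cV[R]_(n + n).
Variables (Om : E -> V -> V -> R) (x0 : E) (U : set E).
Hypotheses (oU : open U) (Ux0 : U x0).
Hypothesis Oalt : forall xi, U xi -> @alternating_bilinear R V R^o (Om xi).
Hypothesis Osmooth : forall a b, smooth_on U (fun xi => Om xi a b).
Hypothesis Ondeg : forall u, (forall v, Om x0 u v = 0) -> u = 0.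

Lemma form_smooth (W : set E) (a b : E -> V) : open W -> W `<=` U ->
  smooth_on W a -> smooth_on W b -> smooth_on W (fun xi => Om xi (a xi) (b xi)).
Proof.
move=> oW WU /(smooth_mx _ oW) sa /(smooth_mx _ oW) sb.
apply: (@smooth_eq _ _ _ _ (fun xi => \sum_i \sum_j
   a xi i 0 * b xi j 0 * Om xi (delta_mx i 0) (delta_mx j 0))) => //.
  by move=> xi /WU Uxi; rewrite [RHS](bilinear_expand _ _ (Oalt Uxi)).
apply: smooth_sum => // i; apply: smooth_sum => // j.
apply: smooth_mul => //; first exact: smooth_mul.
exact: smooth_sub WU _.
Qed.

Lemma open_nonzero (W : set E) (c : E -> R) : open W -> smooth_on W c ->
  open (W `&` [set xi | c xi != 0]).
Proof.
move=> oW sc; rewrite openE => xi [Wxi cxi]; apply: filterI.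
  exact: open_nbhs_nbhs.
have cc : {for xi, continuous c} := differentiable_continuous (smooth_diff sc Wxi).
have n0 : nbhs (c xi) [set r : R | r != 0].
  by apply: open_nbhs_nbhs; split; [exact: open_neq|].
exact: cc n0.
Qed.

(** A smooth symplectic basis of a [2 k]-dimensional subspace over [W]. *)
Definition partial_symplectic (k : nat) (W : set E) (e f : nat -> E -> V) : Prop :=
  [/\ open W, W x0, W `<=` U,
      forall i, (i < k)%N -> smooth_on W (e i) /\ smooth_on W (f i) &
      forall xi i j, W xi -> (i < k)%N -> (j < k)%N ->
        [/\ Om xi (e i xi) (e j xi) = 0, Om xi (f i xi) (f j xi) = 0 &
            Om xi (e i xi) (f j xi) = (i == j)%:R]].

(** These are [2 k] linear conditions on [2 n] unknowns. *)
Lemma exists_orthogonal k (e f : nat -> E -> V) : (k < n)%N ->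
  exists2 a : V, a != 0 &
    forall i, (i < k)%N -> Om x0 a (e i x0) = 0 /\ Om x0 a (f i x0) = 0.
Proof.
move=> kn; have alt0 := Oalt Ux0.
pose row_of (g : nat -> E -> V) : 'M[R]_(n + n, k) :=
  \matrix_(i, j) Om x0 (delta_mx i 0) (g j x0).
pose F := row_mx (row_of e) (row_of f).
have : kermx F != 0.
  rewrite kermx_eq0 -row_leq_rank -ltnNge.
  by apply: leq_ltn_trans (rank_leq_col F) _; rewrite -addSn leq_add // ltnW.
move=> /matrix0Pn[i [j Kij]]; pose a := (row i (kermx F))^T.
exists a; first by apply/matrix0Pn; exists j, 0; rewrite 2!mxE.
have aF : a^T *m F = 0 by rewrite trmxK -row_mul mulmx_ker row0.
have row_ofE g l (lk : (l < k)%N) :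
    Om x0 a (g l x0) = (a^T *m row_of g) 0 (Ordinal lk).
  rewrite mxE {1}(cV_sum a).
  rewrite (big_morph (fun u => Om x0 u _) (fun x y => altDl alt0 x y _) (alt0l alt0 _)).
  by apply: eq_bigr => p _; rewrite (altZl alt0) !mxE.
move: aF; rewrite mul_mx_row -row_mx0 => /eq_row_mx[ae af] l lk.
by rewrite !row_ofE ae af !mxE.
Qed.

(** Gram-Schmidt: [proj v] is [v] minus its projection to the span of the
    partial basis, hence orthogonal to it; a vector [a] which is orthogonal to
    the partial basis at [x0], and a vector [b] with [Om x0 a b != 0], give a
    further hyperbolic pair near [x0]. *)
Lemma partial_symplectic_step k W e f : (k < n)%N ->
  partial_symplectic k W e f ->
  exists W' e' f', partial_symplectic k.+1 W' e' f'.
Proof.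
move=> kn [oW Wx0 WU sef rel].
pose proj (v : V) (xi : E) : V := v - \sum_(i < k)
  (Om xi v (f i xi) *: e i xi - Om xi v (e i xi) *: f i xi).
have Om_proj v w xi : W xi -> Om xi (proj v xi) w = Om xi v w - \sum_(i < k)
  (Om xi v (f i xi) * Om xi (e i xi) w - Om xi v (e i xi) * Om xi (f i xi) w).
  move=> /WU/Oalt al; rewrite /proj (altDl al) (altNl al); congr (_ - _).
  rewrite (big_morph (fun u => Om xi u w) (fun x y => altDl al x y w) (alt0l al w)).
  by apply: eq_bigr => i _; rewrite (altDl al) (altNl al) !(altZl al).
have proj_f v xi j : W xi -> (j < k)%N -> Om xi (proj v xi) (f j xi) = 0.
  move=> Wxi jk; rewrite Om_proj // (bigD1 (Ordinal jk)) //= big1 => [|i ij].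
    have [_ -> ->] := rel xi j j Wxi jk jk.
    by rewrite eqxx mulr1 mulr0 subr0 addr0 subrr.
  have [_ -> ->] := rel xi i j Wxi (ltn_ord i) jk.
  by rewrite (_ : (i == j :> nat) = false) ?mulr0 ?subr0 //; exact: negbTE.
have proj_e v xi j : W xi -> (j < k)%N -> Om xi (proj v xi) (e j xi) = 0.
  move=> Wxi jk; have al := Oalt (WU _ Wxi).
  rewrite Om_proj // (bigD1 (Ordinal jk)) //= big1 => [|i ij].
    have [-> _ _] := rel xi j j Wxi jk jk.
    have [_ _] := rel xi j j Wxi jk jk; rewrite (altC al) eqxx => /(congr1 -%R).
    by rewrite opprK => ->; rewrite mulr0 mulrN1 sub0r opprK addr0 subrr.
  have [-> _ _] := rel xi i j Wxi (ltn_ord i) jk.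
  have [_ _] := rel xi j i Wxi jk (ltn_ord i); rewrite (altC al) => /(congr1 -%R).
  rewrite opprK => ->; rewrite (_ : (j == i :> nat) = false) ?oppr0 ?mulr0 ?subr0 //.
  by rewrite eq_sym; exact: negbTE.
have proj_proj v w xi : W xi -> Om xi (proj v xi) (proj w xi) = Om xi (proj v xi) w.
  move=> Wxi; have al := Oalt (WU _ Wxi).
  rewrite {2}/proj (altDr al) (altNr al).
  rewrite (big_morph (Om xi _) (altDr al _) (alt0r al _)) big1 ?oppr0 ?addr0 //.
  move=> i _; rewrite (altDr al) (altNr al) !(altZr al) proj_e // proj_f //.
  by rewrite !scaler0 subrr.
have sproj v : smooth_on W (proj v).
  have scv : smooth_on W (fun _ : E => v) by exact: smooth_cst.
  apply/(smooth_mx _ oW) => p q.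
  apply: (@smooth_eq _ _ _ _ (fun xi => v p q - \sum_(i < k)
    (Om xi v (f i xi) * e i xi p q - Om xi v (e i xi) * f i xi p q))) => //.
    move=> xi _; rewrite !mxE summxE; congr (_ - _); apply: eq_bigr => i _.
    by rewrite !mxE.
  apply: smooth_add => //; first exact: smooth_cst.
  apply: smooth_opp => //; apply: smooth_sum => // i.
  have [se sf] := sef i (ltn_ord i).
  apply: smooth_add => //; last apply: smooth_opp => //; apply: smooth_mul => //.
  - exact: form_smooth.
  - by move/(smooth_mx _ oW): se.
  - exact: form_smooth.
  - by move/(smooth_mx _ oW): sf.
have [a a0 aef] := exists_orthogonal e f kn.
have [b ab] : exists b, Om x0 a b != 0.
  apply: contrapT => /forallNP H; move/eqP: a0; apply; apply: Ondeg => v.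
  by apply/eqP; apply: contrapT => /negP; exact: H.
pose c xi := Om xi (proj a xi) (proj b xi).
have sc : smooth_on W c by exact: form_smooth.
have c0 : c x0 != 0.
  rewrite /c proj_proj // Om_proj // big1 ?subr0 // => i _.
  by have [-> ->] := aef i (ltn_ord i); rewrite !mul0r subrr.
pose W' := W `&` [set xi | c xi != 0].
exists W', (fun i => if i == k then proj a else e i),
  (fun i => if i == k then fun xi => (c xi)^-1 *: proj b xi else f i).
have oW' : open W' by exact: open_nonzero.
have W'W : W' `<=` W by move=> xi [].
split=> //; first by move=> xi /W'W/WU.
  move=> i; rewrite ltnS leq_eqVlt; case: eqP => [_ _|_ /= ik].
    split; first exact: smooth_sub W'W (sproj a).
    have sW'c := smooth_inv oW' (fun xi (W'xi : W' xi) => W'xi.2)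
      (smooth_sub W'W sc).
    have /(smooth_mx _ oW') sb := smooth_sub W'W (sproj b).
    apply/(smooth_mx _ oW') => p q.
    apply: smooth_eq (smooth_mul oW' sW'c (sb p q)) => // xi _.
    by rewrite [RHS]mxE.
  by have [se sf] := sef i ik; split; exact: smooth_sub W'W _.
move=> xi i j [Wxi cxi]; have al := Oalt (WU _ Wxi).
rewrite 2!ltnS [(i <= k)%N]leq_eqVlt [(j <= k)%N]leq_eqVlt.
case: (i =P k) => [->|_] /=; case: (j =P k) => [->|/eqP jk] /=.
- move=> _ _; have [_ _ aa] := al; rewrite !aa; split=> //.
  by rewrite (altZr al) /GRing.scale /= -/(c xi) mulVf // eqxx.
- move=> _ ltjk; rewrite (altZl al) proj_e // !proj_f // scaler0; split=> //.
  by rewrite eq_sym (negbTE jk).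
- move=> ltik _; have nik : (i == k) = false by rewrite ltn_eqF.
  rewrite (altZr al) [Om xi (e i xi) _](altC al) [Om xi (f i xi) _](altC al).
  rewrite (altZr al) (altC al (e i xi)) !proj_e // !proj_f // nik !oppr0 !scaler0.
  by split.
by move=> ik' jk'; exact: rel.
Qed.

Lemma exists_symplectic_frame :
  exists (W : set E) (S : E -> 'M[R]_(n + n)),
    [/\ open W, W x0, W `<=` U, smooth_on W S &
        forall xi (u v : V), W xi ->
          Om xi (S xi *m u) (S xi *m v) = omega0 u v].
Proof.
have ex k : (k <= n)%N -> exists W e f, partial_symplectic k W e f.
  elim: k => [_|k IH kn].
    by exists U, (fun _ _ => 0), (fun _ _ => 0); split.
  have [W [e [f pef]]] := IH (ltnW kn).
  exact: partial_symplectic_step pef.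
have {ex} := ex n (leqnn n); move=> [W [e [f [oW Wx0 WU sef rel]]]].
pose col_of (g : nat -> E -> V) xi : 'M[R]_(n + n, n) := \matrix_(i, j) g j xi i 0.
pose S xi := row_mx (col_of e xi) (col_of f xi).
have Sl xi i : S xi *m delta_mx (lshift n i) 0 = e i xi.
  by apply/colP => p; rewrite -colE mxE row_mxEl mxE.
have Sr xi i : S xi *m delta_mx (rshift n i) 0 = f i xi.
  by apply/colP => p; rewrite -colE mxE row_mxEr mxE.
exists W, S; split=> //.
  apply/(smooth_mx _ oW) => p q.
  rewrite -(splitK q); case: (fintype.split q) => i /=.
    under eq_fun do rewrite row_mxEl mxE.
    by have [/(smooth_mx _ oW) se _] := sef i (ltn_ord i); exact: se.
  under eq_fun do rewrite row_mxEr mxE.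
  by have [_ /(smooth_mx _ oW) sf] := sef i (ltn_ord i); exact: sf.
move=> xi u v Wxi; have al := Oalt (WU _ Wxi).
have alS : @alternating_bilinear R V R^o (fun u v => Om xi (S xi *m u) (S xi *m v)).
  split=> [a k b c|a k b c|a].
  - by rewrite mulmxDr -scalemxAr (altDr al) (altZr al).
  - by rewrite mulmxDr -scalemxAr (altDl al) (altZl al).
  by have [_ _] := al; exact.
have al0 : @alternating_bilinear R V R^o (@omega0 R n).
  split=> [a|a k b c|a]; first exact: omega0_linear.
    by rewrite omega0Dl omega0Zl.
  exact: omega0_alt.
rewrite [LHS](bilinear_expand u v alS) [RHS](bilinear_expand u v al0).
apply: eq_bigr => i _; apply: eq_bigr => j _; congr (_ * _).
rewrite -(splitK i) -(splitK j).
case: (fintype.split i) => i'; case: (fintype.split j) => j' /=.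
- have [Oee _ _] := rel xi i' j' Wxi (ltn_ord _) (ltn_ord _).
  by rewrite !Sl Oee omega0_lshift mxE eq_rlshift oppr0.
- have [_ _ Oef] := rel xi i' j' Wxi (ltn_ord _) (ltn_ord _).
  rewrite Sl Sr Oef omega0_rshift mxE eqxx andbT.
  by rewrite (inj_eq (@lshift_inj n n)) eq_sym.
- have [_ _ Oef] := rel xi j' i' Wxi (ltn_ord _) (ltn_ord _).
  rewrite Sl Sr (altC al) Oef omega0_lshift mxE eqxx andbT.
  by rewrite (inj_eq (@rshift_inj n n)).
have [_ Off _] := rel xi i' j' Wxi (ltn_ord _) (ltn_ord _).
by rewrite !Sr Off omega0_rshift mxE eq_lrshift.
Qed.

End SmoothGramSchmidt.

(** * From a flat symplectic manifold to a homogeneous structure *)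

Section Converse.
Variables (R : realType) (n : nat) (M : manifold R (n + n)) (D : connection M).
Variable omega : form2 M.
Arguments omega : clear implicits.
Local Notation V := 'cV[R]_(n + n).
Implicit Types (x y : M) (U : set M) (X Y Z : vfield M) (s : M -> 'M[R]_(n + n)).
Hypothesis omS : symplectic_form omega.

Lemma symplectic_frame_unit x (p : 'M[R]_(n + n)) :
  (forall u v : V, omega x (p *m u) (p *m v) = omega0 u v) -> p \in unitmx.
Proof.
move=> pP; apply: mx_inj_unit => v pv; apply: omega0_nondeg => w.
by case: omS => al _ _ _; rewrite -pP pv (alt0l (al x)).
Qed.

(** Fields with constant components in a chart, on which the smoothness of
    [omega] can be tested. *)
Definition chart_field x (a : V) : vfield M := fun y => invmx (jacobian x y) *m a.

Lemma chart_fieldE x y a : dom (chart_at x) y ->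
  tangent_coord x y (chart_field x a y) = a.
Proof. by move=> xy; rewrite tangent_coordE mulKVmx // jacobian_unit. Qed.

Lemma chart_field_smooth x a : smooth_vfield_on (dom (chart_at x)) (chart_field x a).
Proof.
have od : open (dom (chart_at x)) by exact: dom_open.
apply: (smooth_vfield_chart (x := x)) => //.
apply: (@smooth_eq _ _ _ _ (fun=> a)).
- exact: open_chart_image.
- by move=> xi /chart_image_param[xy _ _]; rewrite /vfield_coord chart_fieldE.
exact: smooth_cst.
Qed.

(** Read [omega] in a chart, apply Gram-Schmidt there, and carry the frame so
    obtained back to the tangent spaces by the inverse of the Jacobian matrix. *)
Lemma exists_symplectic_section x :
  exists s U, open_nbhs x U /\ local_section (symplectic_frames omega) U s.
Proof.
have [al osm ndeg _] := omS; set c := chart_at x.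
have xx : dom c x := mem_chart x.
pose Om (xi : V) (a b : V) : R :=
  form2_eval omega (chart_field x a) (chart_field x b) (param c xi).
have od : open (dom c) by exact: dom_open.
have ocd : open (coord c @` dom c) by exact: coord_open.
have ccx : (coord c @` dom c) (coord c x) by exists x.
have Oalt xi : (coord c @` dom c) xi -> @alternating_bilinear R V R^o (Om xi).
  move=> _; have ax := al (param c xi).
  split=> [a k b e|a k b e|a]; rewrite /Om /form2_eval /chart_field.
  - by rewrite mulmxDr -scalemxAr (altDr ax) (altZr ax).
  - by rewrite mulmxDr -scalemxAr (altDl ax) (altZl ax).
  by have [_ _] := ax; exact.
have Osmooth a b : smooth_on (coord c @` dom c) (fun xi => Om xi a b).
  have := osm _ _ _ od (chart_field_smooth x a) (chart_field_smooth x b).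
  by move=> /(_ x); rewrite setIid.
have Ondeg u : (forall v, Om (coord c x) u v = 0) -> u = 0.
  rewrite /Om /form2_eval coordK // => Ou.
  have uj := jacobian_unit xx.
  have H : chart_field x u x = 0 :> V.
    apply: (ndeg x) => v; have := Ou (jacobian x x *m v).
    by rewrite /chart_field mulKmx.
  by rewrite -(chart_fieldE u xx) tangent_coordE H mulmx0.
have [W [S [oW Wcx WU sS SP]]] :=
  exists_symplectic_frame ocd ccx Oalt Osmooth Ondeg.
pose U := dom c `&` coord c @^-1` W.
have oU : open U by exact: open_coord_preimage.
pose s (y : M) : 'M[R]_(n + n) := invmx (jacobian x y) *m S (coord c y).
have sE y (a b : V) : U y -> omega y (s y *m a) (s y *m b) = omega0 a b.
  move=> [cy Wy]; rewrite -(SP (coord c y) a b Wy) /Om /form2_eval coordK //.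
  by rewrite /chart_field /s !mulmxA.
exists s, U; split; first by split=> //; split.
split=> [y Uy|w].
  by split=> [|a b]; [apply: (@symplectic_frame_unit y) => a b|]; exact: sE.
apply: (smooth_vfield_chart (x := x)) => //; first by move=> y [].
apply: (@smooth_eq _ _ _ _ (fun xi => S xi *m w)).
- exact: open_chart_image.
- move=> xi /chart_image_param[xy Uy xiE]; rewrite vfield_coordE.
  by rewrite mulmxA mulmxA mulmxV ?jacobian_unit // mul1mx xiE.
apply: smooth_mulmx; first exact: open_chart_image.
  apply: smooth_sub sS => xi /chart_image_param[xy [_ Uy] <-].
  by [].
exact: smooth_cst.
Qed.

Lemma symplectic_G_structure :
  G_structure (Sp R n) (symplectic_frames omega).
Proof.
split.
- by move=> x p [].
- move=> x p [up pP]; apply/seteqP; split=> q.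
    move=> [uq qP]; exists (invmx p *m q); last by rewrite mulKVmx.
    have H u v : omega0 (invmx p *m q *m u) (invmx p *m q *m v) = omega0 u v.
      by rewrite -pP !mulmxA mulmxV // !mul1mx qP.
    by split; [exact: omega0_preserving_unit|].
  move=> [g [ug gP] <-].
  have H (u v : V) : omega x (p *m g *m u) (p *m g *m v) = omega0 u v.
    by rewrite -!mulmxA pP gP.
  by split; [exact: symplectic_frame_unit H|].
exact: exists_symplectic_section.
Qed.

Hypothesis symD : symplectic_connection D omega.

(** Differentiate the constant functions [omega (s w, s z)] along [s u]. *)
Lemma symplectic_Lambda U s x u L : open U -> U x ->
  local_section (symplectic_frames omega) U s -> is_Lambda D s x u L -> sp L.
Proof.
move=> oU Ux [Ps ss] sL w z; have [us sP] := Ps x Ux.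
pose S (a : V) : vfield M := fun y => s y *m a.
have nS a : smooth_vfield_near x (S a) by exists U => //; exact: ss.
have := symD (nS u) (nS w) (nS z).
rewrite /cov_form2 /form2_eval /cov (@dfun_eq _ _ _ x (S u x) U (fun=> omega0 w z)) //;
  first last.
- exact: smooth_near_cst.
- by move=> y Uy; have [_ yP] := Ps y Uy; rewrite /S yP.
rewrite dfun_cst sub0r -opprD => /eqP; rewrite oppr_eq0 => /eqP.
have -> : D x (S u x) (S w) = s x *m (L *m w) by exact: sL.
have -> : D x (S u x) (S z) = s x *m (L *m z) by exact: sL.
by rewrite !sP.
Qed.

(** All characteristic tensors are zero. For the inner torsion, the matrix of the
    connection in any section is in [sp], hence of class zero, and conjugation
    by any symplectic frame sends [sp] to the same set, since [sp] is stable under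
    conjugation by the symplectic group. *)
Lemma symplectic_homogeneous : torsion_free D -> flat D ->
  infinitesimally_homogeneous (Sp R n) D (symplectic_frames omega).
Proof.
move=> tf fl; exists (fun _ _ => 0), (fun _ _ => 0), (fun _ => sp).
have zlin (W : lmodType R) : alternating_bilinear (fun _ _ : V => 0 : W).
  by split=> [u a v w|u a v w|u]; rewrite ?scaler0 ?addr0.
split; rewrite ?lie_algebra_Sp; try exact: zlin.
  split=> [u|a u v A B]; first by exists 0; rewrite coset_sp //; exact: sp0.
  have in_coset A' : sp = coset sp A' -> sp A'.
    move=> E; rewrite E; exists 0; last by rewrite addr0.
    exact: sp0.
  by move=> /in_coset sA /in_coset sB; rewrite coset_sp //; exact: sp_linear.
move=> x p Pp; have [_ GPx _] := symplectic_G_structure.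
have [up pP] := Pp; split.
- by move=> u v X Y sX sY _ _; rewrite tf // mulmx0.
- by move=> u v w X Y Z sX sY sZ _ _ _; rewrite fl // mul0mx mulmx0.
move=> u.
have AdSp q : symplectic_frames omega x q -> Ad q @` sp = Ad p @` sp.
  rewrite (GPx x p Pp) => -[g gSp <-]; have [ug _] := gSp.
  have upg : p *m g \in unitmx by rewrite unitmx_mul up.
  have AdM A : Ad (p *m g) A = Ad p (Ad g A).
    rewrite /Ad -!mulmxA; congr (_ *m (_ *m (_ *m _))).
    apply: (can_inj (mulKmx upg)).
    by rewrite mulmxV // -mulmxA mulKVmx // mulmxV.
  apply/seteqP; split=> B [A sA <-].
    by exists (Ad g A); [exact: sp_conj|rewrite AdM].
  exists (Ad (invmx g) A); first by exact: sp_conj (SpV gSp) sA.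
  rewrite AdM; congr (Ad p _); rewrite /Ad invmxK !mulmxA mulmxV // mul1mx.
  by rewrite -mulmxA mulmxV // mulmx1.
apply/seteqP; split=> B.
  move=> [s [U [u' [L [[oU Ux] sU _ sL]]]]].
  rewrite lie_algebra_Sp coset_sp; last exact: symplectic_Lambda sU sL.
  by case: sU => Ps _; rewrite AdSp //; exact: Ps.
move=> [A sA <-]; have [s [U [[oU Ux] sU]]] := exists_symplectic_section x.
have [Ps ss] := sU; have [us sP] := Ps x Ux.
have sf : smooth_frame U s by split=> // y /Ps[].
have [L sL] := is_Lambda_exists D (invmx (s x) *m (p *m u)) oU Ux sf.
exists s, U, (invmx (s x) *m (p *m u)), L; split=> //.
  by rewrite mulKVmx.
rewrite lie_algebra_Sp coset_sp; last exact: symplectic_Lambda sU sL.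
by rewrite AdSp; [exists A|exact: Ps].
Qed.

End Converse.

Theorem theorem3p3 (R : realType) (n : nat) (n_gt0 : (0 < n)%N)
    (M : manifold R (n + n)) (D : connection M) :
  (forall P : M -> set 'M[R]_(n + n),
     G_structure (Sp R n) P ->
     infinitesimally_homogeneous (Sp R n) D P ->
     exists omega : form2 M,
       [/\ symplectic_form omega,
           (forall x : M, P x = symplectic_frames omega x),
           torsion_free D,
           flat D &
           symplectic_connection D omega])
  /\
  (forall omega : form2 M,
     symplectic_form omega ->
     torsion_free D ->
     flat D ->
     symplectic_connection D omega ->
     G_structure (Sp R n) (symplectic_frames omega) /\
     infinitesimally_homogeneous (Sp R n) D (symplectic_frames omega)).
Proof.
split=> [P|omega omS tf fl symD]; first exact: homogeneous_symplectic.
by split; [exact: symplectic_G_structure|exact: symplectic_homogeneous].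
Qed.
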